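(* The system $\mathsf{ACA}_0^\omega+\mathsf{LIND}_4$ proves $\Pi^1_1\text{-}\mathsf{CA}_0$, where $\mathsf{LIND}_4$ (the Lindelöf lemma for Baire space) is the statement $$(\forall\Psi^2)(\exists f_{(\cdot)}^{0\to1})(\forall g^1)(\exists n^0)\big(g\in[\overline{f_n}\Psi(f_n)]\big).$$
   Context: Language and base theory. Finite types: $0$ (natural numbers) is a type, and if $\sigma,\tau$ are types then so is $\sigma\to\tau$ (mappings); $1:=0\to 0$ and $n+1:=n\to 0$; $\rho^*$ is the type of finite sequences of type-$\rho$ objects (suitably coded). Superscripts on variables indicate types. $\mathsf{L}_\omega$ is the language with variables of all finite types, constants $0,1,<_0,+_0,\times_0,=_0$, the combinators and recursors. Equality $=_\tau$ and $\leq_\tau$ at type $\tau=\tau_1\to\dots\to\tau_k\to 0$ are defined pointwise from $=_0$, $\leq_0$. Quantifier-free formulas may contain variables of any type. The axiom $\mathsf{QF\text{-}AC}^{\sigma,\tau}$ is $(\forall x^\sigma)(\exists y^\tau)A(x,y)\to(\exists Y^{\sigma\to\tau})(\forall x^\sigma)A(x,Y(x))$ for all quantifier-free $A$. The (classical) system $\mathsf{RCA}_0^\omega$ consists of: the ordered semi-ring axioms for $0,1,<_0,+_0,\times_0$; the defining axioms of the $\Pi$ and $\Sigma$ (i.e. $K$ and $S$) combinators, yielding $\lambda$-abstraction; the recursor $\mathbf{R}_0$ with $\mathbf{R}_0(f,m,0)=m$ and $\mathbf{R}_0(f,m,n+1)=f(\mathbf{R}_0(f,m,n))$ for $m^0,f^1$;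 the axiom of extensionality $x=_\rho y\to\varphi(x)=_\tau\varphi(y)$ for all types $\rho,\tau$; induction for quantifier-free formulas; and $\mathsf{QF\text{-}AC}^{1,0}$. The axiom $(\mu^2)$ is $(\exists\mu^2)(\forall f^1)\big[(\exists n)(f(n)=0)\to f(\mu(f))=0\big]$, and $\mathsf{ACA}_0^\omega:=\mathsf{RCA}_0^\omega+(\mu^2)$. For $g^1$, $\overline{g}n=\langle g(0),\dots,g(n-1)\rangle$, and $[\sigma]$ is the set of all $g\in\mathbb{N}^{\mathbb{N}}$ extending the finite sequence $\sigma$. $\Pi^1_1\text{-}\mathsf{CA}_0$ is second-order arithmetic with comprehension $(\exists X)(\forall n)(n\in X\leftrightarrow\varphi(n))$ restricted to $\Pi^1_1$-formulas $\varphi$ (with parameters); sets of numbers are identified with their characteristic functions of type $1$. *)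

(* Defs.v *)
From Stdlib Require Import List.
Import ListNotations.

Set Implicit Arguments.
Unset Strict Implicit.
Unset Printing Implicit Defensive.

(** Terms and formulas are intrinsically typed, with de Bruijn variables: a
    formula of type [fm G] has its free variables in the context [G], and
    sentences have type [fm []]. *)

Inductive ty : Type :=
| N : ty
| Arr : ty -> ty -> ty.

Declare Scope ty_scope.
Delimit Scope ty_scope with ty.
Bind Scope ty_scope with ty.
Notation "s ~> t" := (Arr s t) (at level 90, right associativity) : ty_scope.

Notation ty1 := (Arr N N).
Notation ty2 := (Arr (Arr N N) N).

(* Variables are generic in the type of sorts, as they also serve for the
   two-sorted language of second-order arithmetic below. *)
Inductive var {A : Type} : list A -> A -> Type :=
| V0 : forall (G : list A) (s : A), var (s :: G) s
| VS : forall (G : list A) (s t : A), var G s -> var (t :: G) s.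

Arguments V0 {A G s}.
Arguments VS {A G s t} _.

(* Application and the combinators give lambda-abstraction, so terms bind no
   variables.  The language has recursors of all types, but only the one of
   type 0 is governed by an axiom of [RCA0w]. *)
Inductive const : ty -> Type :=
| cZero : const N
| cOne  : const N
| cAdd  : const (N ~> N ~> N)
| cMul  : const (N ~> N ~> N)
| cK    : forall r s : ty, const (r ~> s ~> r)
| cS    : forall r s t : ty, const ((r ~> s ~> t) ~> (r ~> s) ~> r ~> t)
| cR    : forall s : ty, const ((s ~> s) ~> s ~> N ~> s).

Inductive tm (G : list ty) : ty -> Type :=
| Var : forall s : ty, var G s -> tm G s
| Cst : forall s : ty, const s -> tm G s
| App : forall s t : ty, tm G (s ~> t) -> tm G s -> tm G t.

Arguments Cst {G s} _.

Inductive fm : list ty -> Type :=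
| Eq0 : forall G : list ty, tm G N -> tm G N -> fm G
| Lt0 : forall G : list ty, tm G N -> tm G N -> fm G
| Bot : forall G : list ty, fm G
| Imp : forall G : list ty, fm G -> fm G -> fm G
| And : forall G : list ty, fm G -> fm G -> fm G
| Or  : forall G : list ty, fm G -> fm G -> fm G
| All : forall (G : list ty) (s : ty), fm (s :: G) -> fm G
| Ex  : forall (G : list ty) (s : ty), fm (s :: G) -> fm G.

Arguments Bot {G}.
Arguments All {G} s _.
Arguments Ex {G} s _.

Declare Scope fm_scope.
Delimit Scope fm_scope with fm.
Bind Scope fm_scope with tm.
Bind Scope fm_scope with fm.
Open Scope fm_scope.

Notation "#0" := (Var V0) : fm_scope.
Notation "#1" := (Var (VS V0)) : fm_scope.
Notation "#2" := (Var (VS (VS V0))) : fm_scope.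
Notation "#3" := (Var (VS (VS (VS V0)))) : fm_scope.

Notation "f @ x" := (App f x) (at level 31, left associativity) : fm_scope.
Notation "'`0'" := (Cst cZero) : fm_scope.
Notation "'`1'" := (Cst cOne) : fm_scope.
Notation "a +' b" := (Cst cAdd @ a @ b) (at level 50, left associativity) : fm_scope.
Notation "a *' b" := (Cst cMul @ a @ b) (at level 40, left associativity) : fm_scope.
Notation "a =' b" := (Eq0 a b) (at level 70, no associativity) : fm_scope.
Notation "a <' b" := (Lt0 a b) (at level 70, no associativity) : fm_scope.
Notation "A /\' B" := (And A B) (at level 80, right associativity) : fm_scope.
Notation "A \/' B" := (Or A B) (at level 85, right associativity) : fm_scope.
Notation "A -->' B" := (Imp A B) (at level 99, right associativity, B at level 200) : fm_scope.
Notation "~' A" := (Imp A Bot) (at level 75, right associativity) : fm_scope.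

Definition subst (G D : list ty) : Type := forall s : ty, var G s -> tm D s.

Definition scons (G D : list ty) (r : ty) (a : tm D r) (f : subst G D) :
    subst (r :: G) D :=
  fun s v =>
    match v in var G0 s0
      return match G0 with
             | [] => unit
             | r' :: G' => tm D r' -> subst G' D -> tm D s0
             end
    with
    | V0 => fun a' _ => a'
    | VS w => fun _ f' => f' _ w
    end a f.

Fixpoint tsub (G D : list ty) (f : subst G D) (s : ty) (a : tm G s) : tm D s :=
  match a with
  | Var v => f _ v
  | Cst c => Cst c
  | App b c => App (tsub f b) (tsub f c)
  end.

Definition ids (G : list ty) : subst G G := fun s v => Var v.
Definition shift (G : list ty) (r : ty) : subst G (r :: G) := fun s v => Var (VS v).
Definition from_nil (D : list ty) : subst [] D :=
  fun s v => match v in var G0 s0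
               return match G0 with [] => tm D s0 | _ :: _ => unit end
             with V0 => tt | VS _ => tt end.

Definition up (G D : list ty) (r : ty) (f : subst G D) : subst (r :: G) (r :: D) :=
  scons #0 (fun s v => tsub (@shift D r) (f s v)).

Fixpoint fsub (G : list ty) (A : fm G) : forall D : list ty, subst G D -> fm D :=
  match A with
  | Eq0 a b => fun D f => Eq0 (tsub f a) (tsub f b)
  | Lt0 a b => fun D f => Lt0 (tsub f a) (tsub f b)
  | Bot => fun D f => Bot
  | Imp A B => fun D f => Imp (fsub A f) (fsub B f)
  | And A B => fun D f => And (fsub A f) (fsub B f)
  | Or A B => fun D f => Or (fsub A f) (fsub B f)
  | All s A => fun D f => All s (fsub A (up f))
  | Ex s A => fun D f => Ex s (fsub A (up f))
  end.

Definition twk (G : list ty) (r s : ty) (a : tm G s) : tm (r :: G) s :=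
  tsub (@shift G r) a.
Definition wk (G : list ty) (r : ty) (A : fm G) : fm (r :: G) := fsub A (@shift G r).
Definition inst (G : list ty) (r : ty) (A : fm (r :: G)) (a : tm G r) : fm G :=
  fsub A (scons a (@ids G)).

Fixpoint close (G : list ty) : fm G -> fm [] :=
  match G with
  | [] => fun A => A
  | s :: G' => fun A => close (All s A)
  end.

(** Classical natural deduction.  [prv T D A]: the formula [A] is derivable from the hypotheses [D] and the
    sentences of the theory [T].  Type-0 equality is treated as the equality of
    the logic; equality at higher types is a defined notion. *)

Definition theory : Type := fm [] -> Prop.

Inductive prv (T : theory) : forall G : list ty, list (fm G) -> fm G -> Prop :=
| prv_ax : forall (G : list ty) (D : list (fm G)) (A : fm []),
    T A -> prv T D (fsub A (@from_nil G))
| prv_hyp : forall (G : list ty) (D : list (fm G)) (A : fm G),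
    In A D -> prv T D A
| prv_raa : forall (G : list ty) (D : list (fm G)) (A : fm G),
    prv T ((~' A) :: D) Bot -> prv T D A
| prv_impI : forall (G : list ty) (D : list (fm G)) (A B : fm G),
    prv T (A :: D) B -> prv T D (A -->' B)
| prv_impE : forall (G : list ty) (D : list (fm G)) (A B : fm G),
    prv T D (A -->' B) -> prv T D A -> prv T D B
| prv_andI : forall (G : list ty) (D : list (fm G)) (A B : fm G),
    prv T D A -> prv T D B -> prv T D (A /\' B)
| prv_andE1 : forall (G : list ty) (D : list (fm G)) (A B : fm G),
    prv T D (A /\' B) -> prv T D A
| prv_andE2 : forall (G : list ty) (D : list (fm G)) (A B : fm G),
    prv T D (A /\' B) -> prv T D B
| prv_orI1 : forall (G : list ty) (D : list (fm G)) (A B : fm G),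
    prv T D A -> prv T D (A \/' B)
| prv_orI2 : forall (G : list ty) (D : list (fm G)) (A B : fm G),
    prv T D B -> prv T D (A \/' B)
| prv_orE : forall (G : list ty) (D : list (fm G)) (A B C : fm G),
    prv T D (A \/' B) -> prv T (A :: D) C -> prv T (B :: D) C -> prv T D C
| prv_allI : forall (G : list ty) (D : list (fm G)) (s : ty) (A : fm (s :: G)),
    prv T (map (@wk G s) D) A -> prv T D (All s A)
| prv_allE : forall (G : list ty) (D : list (fm G)) (s : ty) (A : fm (s :: G)) (a : tm G s),
    prv T D (All s A) -> prv T D (inst A a)
| prv_exI : forall (G : list ty) (D : list (fm G)) (s : ty) (A : fm (s :: G)) (a : tm G s),
    prv T D (inst A a) -> prv T D (Ex s A)
| prv_exE : forall (G : list ty) (D : list (fm G)) (s : ty) (A : fm (s :: G)) (C : fm G),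
    prv T D (Ex s A) -> prv T (A :: map (@wk G s) D) (wk s C) -> prv T D C
| prv_eqI : forall (G : list ty) (D : list (fm G)) (a : tm G N),
    prv T D (a =' a)
| prv_eqE : forall (G : list ty) (D : list (fm G)) (A : fm (N :: G)) (a b : tm G N),
    prv T D (a =' b) -> prv T D (inst A a) -> prv T D (inst A b).

Definition proves (T : theory) (A : fm []) : Prop := prv T [] A.

Definition add_axiom (T : theory) (A : fm []) : theory := fun B => T B \/ B = A.

Fixpoint eq_at (s : ty) : forall G : list ty, tm G s -> tm G s -> fm G :=
  match s with
  | N => fun G a b => a =' b
  | Arr r t => fun G a b => All r (eq_at (twk r a @ #0) (twk r b @ #0))
  end.

Fixpoint qf (G : list ty) (A : fm G) : bool :=
  match A with
  | Eq0 _ _ | Lt0 _ _ | Bot => true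
  | Imp A B | And A B | Or A B => andb (qf A) (qf B)
  | All _ _ | Ex _ _ => false
  end.

(* Nonnegativity and discreteness of the order, which are not listed here,
   follow by quantifier-free induction. *)
Definition ordered_semiring_axioms : list (fm []) :=
  [ All N (All N (All N ((#2 +' #1) +' #0 =' #2 +' (#1 +' #0))));
    All N (All N (#1 +' #0 =' #0 +' #1));
    All N (#0 +' `0 =' #0);
    All N (All N (All N ((#2 *' #1) *' #0 =' #2 *' (#1 *' #0))));
    All N (All N (#1 *' #0 =' #0 *' #1));
    All N (#0 *' `1 =' #0);
    All N (#0 *' `0 =' `0);
    All N (All N (All N (#2 *' (#1 +' #0) =' #2 *' #1 +' #2 *' #0)));
    All N (~' (#0 <' #0));
    All N (All N (All N (#2 <' #1 /\' #1 <' #0 -->' #2 <' #0)));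
    All N (All N (#1 <' #0 \/' #1 =' #0 \/' #0 <' #1));
    All N (All N (All N (#2 <' #1 -->' #2 +' #0 <' #1 +' #0)));
    All N (All N (All N (`0 <' #0 /\' #2 <' #1 -->' #2 *' #0 <' #1 *' #0)));
    `0 <' `1 ].

Definition ax_K (r s : ty) : fm [] :=
  All r (All s (eq_at (Cst (cK r s) @ #1 @ #0) #1)).

Definition ax_S (r s t : ty) : fm [] :=
  All (r ~> s ~> t) (All (r ~> s) (All r
    (eq_at (Cst (cS r s t) @ #2 @ #1 @ #0) (#2 @ #0 @ (#1 @ #0))))).

Definition ax_R_zero : fm [] :=
  All ty1 (All N (Cst (cR N) @ #1 @ #0 @ `0 =' #0)).

Definition ax_R_succ : fm [] :=
  All ty1 (All N (All N
    (Cst (cR N) @ #2 @ #1 @ (#0 +' `1) =' #2 @ (Cst (cR N) @ #2 @ #1 @ #0)))).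

Definition ax_ext (r t : ty) : fm [] :=
  All (r ~> t) (All r (All r (eq_at #1 #0 -->' eq_at (#2 @ #1) (#2 @ #0)))).

Definition induction_for (G : list ty) (A : fm (N :: G)) : fm [] :=
  close (inst A `0 /\' All N (A -->' fsub A (scons (#0 +' `1) (@shift G N)))
         -->' All N A).

(* [A] has the free variables [x] = [#1] and [y] = [#0], and parameters in [G];
   in the conclusion they become [x] and [Y x], where [x] = [#0], [Y] = [#1]. *)
Definition choice_for (s t : ty) (G : list ty) (A : fm (t :: s :: G)) : fm [] :=
  close (All s (Ex t A) -->'
         Ex (s ~> t) (All s
           (fsub A (scons (#1 @ #0) (scons #0 (fun r v => Var (VS (VS v)))))))).

Inductive QF_AC (s t : ty) : theory :=
| QF_AC_intro : forall (G : list ty) (A : fm (t :: s :: G)),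
    qf A = true -> QF_AC s t (choice_for A).

Inductive RCA0w : theory :=
| RCA0w_semiring : forall A : fm [], In A ordered_semiring_axioms -> RCA0w A
| RCA0w_K : forall r s : ty, RCA0w (ax_K r s)
| RCA0w_S : forall r s t : ty, RCA0w (ax_S r s t)
| RCA0w_R_zero : RCA0w ax_R_zero
| RCA0w_R_succ : RCA0w ax_R_succ
| RCA0w_ext : forall r t : ty, RCA0w (ax_ext r t)
| RCA0w_induction : forall (G : list ty) (A : fm (N :: G)),
    qf A = true -> RCA0w (induction_for A)
| RCA0w_choice : forall A : fm [], QF_AC ty1 N A -> RCA0w A.

Definition mu2 : fm [] :=
  Ex ty2 (All ty1 (Ex N (#1 @ #0 =' `0) -->' #0 @ (#1 @ #0) =' `0)).

Definition ACA0w : theory := add_axiom RCA0w mu2.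

(* A finite sequence of numbers, given by its length and by a function listing
   its entries (whose values beyond the length are irrelevant). *)
Record fseq (G : list ty) : Type := Fseq {
  fseq_len : tm G N;
  fseq_entry : tm G ty1
}.

Definition initseg (G : list ty) (g : tm G ty1) (n : tm G N) : fseq G := Fseq n g.

Definition in_nbhd (G : list ty) (g : tm G ty1) (u : fseq G) : fm G :=
  All N (#0 <' twk N (fseq_len u) -->' twk N g @ #0 =' twk N (fseq_entry u) @ #0).

(* Innermost scope: [#3] is Psi, [#2] the sequence of functions, [#1] is g, [#0] is n. *)
Definition LIND4 : fm [] :=
  All ty2 (Ex (N ~> ty1) (All ty1 (Ex N
    (in_nbhd #1 (initseg (#2 @ #0) (#3 @ (#2 @ #0))))))).

Inductive sort : Type := Num | Set_.

Inductive tm2 (G : list sort) : Type :=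
| Var2 : var G Num -> tm2 G
| Zero2 : tm2 G
| One2 : tm2 G
| Add2 : tm2 G -> tm2 G -> tm2 G
| Mul2 : tm2 G -> tm2 G -> tm2 G.

Arguments Zero2 {G}.
Arguments One2 {G}.

Inductive fm2 : list sort -> Type :=
| Eq2 : forall G : list sort, tm2 G -> tm2 G -> fm2 G
| Lt2 : forall G : list sort, tm2 G -> tm2 G -> fm2 G
| Mem2 : forall G : list sort, tm2 G -> var G Set_ -> fm2 G
| Bot2 : forall G : list sort, fm2 G
| Imp2 : forall G : list sort, fm2 G -> fm2 G -> fm2 G
| And2 : forall G : list sort, fm2 G -> fm2 G -> fm2 G
| Or2  : forall G : list sort, fm2 G -> fm2 G -> fm2 G
| All2 : forall (G : list sort) (s : sort), fm2 (s :: G) -> fm2 G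
| Ex2  : forall (G : list sort) (s : sort), fm2 (s :: G) -> fm2 G.

Arguments Bot2 {G}.
Arguments All2 {G} s _.
Arguments Ex2 {G} s _.

Definition Not2 (G : list sort) (A : fm2 G) : fm2 G := Imp2 A Bot2.
Definition Iff2 (G : list sort) (A B : fm2 G) : fm2 G := And2 (Imp2 A B) (Imp2 B A).

Definition renaming (G D : list sort) : Type := forall s : sort, var G s -> var D s.

Definition up_ren (G D : list sort) (r : sort) (f : renaming G D) :
    renaming (r :: G) (r :: D) :=
  fun s v =>
    match v in var G0 s0
      return match G0 with
             | [] => unit
             | r' :: G' => renaming G' D -> var (r' :: D) s0
             end
    with
    | V0 => fun _ => V0
    | VS w => fun f' => VS (f' _ w)
    end f.

Fixpoint tren2 (G D : list sort) (f : renaming G D) (a : tm2 G) : tm2 D :=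
  match a with
  | Var2 v => Var2 (f _ v)
  | Zero2 => Zero2
  | One2 => One2
  | Add2 a b => Add2 (tren2 f a) (tren2 f b)
  | Mul2 a b => Mul2 (tren2 f a) (tren2 f b)
  end.

Fixpoint fren2 (G : list sort) (A : fm2 G) : forall D : list sort, renaming G D -> fm2 D :=
  match A with
  | Eq2 a b => fun D f => Eq2 (tren2 f a) (tren2 f b)
  | Lt2 a b => fun D f => Lt2 (tren2 f a) (tren2 f b)
  | Mem2 a X => fun D f => Mem2 (tren2 f a) (f _ X)
  | Bot2 => fun D f => Bot2
  | Imp2 A B => fun D f => Imp2 (fren2 A f) (fren2 B f)
  | And2 A B => fun D f => And2 (fren2 A f) (fren2 B f)
  | Or2 A B => fun D f => Or2 (fren2 A f) (fren2 B f)
  | All2 s A => fun D f => All2 s (fren2 A (up_ren f))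
  | Ex2 s A => fun D f => Ex2 s (fren2 A (up_ren f))
  end.

Fixpoint close2 (G : list sort) : fm2 G -> fm2 [] :=
  match G with
  | [] => fun A => A
  | s :: G' => fun A => close2 (All2 s A)
  end.

Fixpoint arithmetical (G : list sort) (A : fm2 G) : bool :=
  match A with
  | Eq2 _ _ | Lt2 _ _ | Mem2 _ _ | Bot2 => true
  | Imp2 A B | And2 A B | Or2 A B => andb (arithmetical A) (arithmetical B)
  | All2 Num A | Ex2 Num A => arithmetical A
  | All2 Set_ _ | Ex2 Set_ _ => false
  end.

Definition Pi11 (G : list sort) (A : fm2 G) : Prop :=
  exists B : fm2 (Set_ :: G), arithmetical B = true /\ A = All2 Set_ B.

(* The variable [n] of [phi] is [#0]; the set asserted to exist, inserted at
   position 1, does not occur in [phi]. *)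
Definition comprehension_for (G : list sort) (phi : fm2 (Num :: G)) : fm2 [] :=
  close2 (Ex2 Set_ (All2 Num
    (Iff2 (Mem2 (Var2 V0) (VS V0))
          (fren2 phi (up_ren (fun s v => VS v)))))).

Definition basic_axioms2 : list (fm2 []) :=
  let x G := @Var2 (Num :: G) V0 in
  let m := @Var2 [Num; Num] (VS V0) in
  let n := @Var2 [Num; Num] V0 in
  [ All2 Num (Not2 (Eq2 (Add2 (x _) One2) Zero2));
    All2 Num (All2 Num (Imp2 (Eq2 (Add2 m One2) (Add2 n One2)) (Eq2 m n)));
    All2 Num (Eq2 (Add2 (x _) Zero2) (x _));
    All2 Num (All2 Num (Eq2 (Add2 m (Add2 n One2)) (Add2 (Add2 m n) One2)));
    All2 Num (Eq2 (Mul2 (x _) Zero2) Zero2);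
    All2 Num (All2 Num (Eq2 (Mul2 m (Add2 n One2)) (Add2 (Mul2 m n) m)));
    All2 Num (Not2 (Lt2 (x _) Zero2));
    All2 Num (All2 Num (Iff2 (Lt2 m (Add2 n One2)) (Or2 (Lt2 m n) (Eq2 m n)))) ].

Definition set_induction : fm2 [] :=
  All2 Set_
    (Imp2 (And2 (Mem2 Zero2 V0)
                (All2 Num (Imp2 (Mem2 (Var2 V0) (VS V0))
                                (Mem2 (Add2 (Var2 V0) One2) (VS V0)))))
          (All2 Num (Mem2 (Var2 V0) (VS V0)))).

Inductive Pi11_CA0 : fm2 [] -> Prop :=
| Pi11_CA0_basic : forall A : fm2 [], In A basic_axioms2 -> Pi11_CA0 A
| Pi11_CA0_induction : Pi11_CA0 set_induction
| Pi11_CA0_comp : forall (G : list sort) (phi : fm2 (Num :: G)),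
    Pi11 phi -> Pi11_CA0 (comprehension_for phi).

(** Sets are identified with their characteristic functions: set quantifiers
    range over the 0-1-valued [f] of type 1, and [n] belongs to [f] when
    [f n = 1]. *)

Definition ty_of_sort (s : sort) : ty :=
  match s with Num => N | Set_ => ty1 end.

Definition ctx_of (G : list sort) : list ty := map ty_of_sort G.

Fixpoint var_of (G : list sort) (s : sort) (v : var G s) :
    var (ctx_of G) (ty_of_sort s) :=
  match v with
  | V0 => V0
  | VS w => VS (var_of w)
  end.

Fixpoint tm_of (G : list sort) (a : tm2 G) : tm (ctx_of G) N :=
  match a with
  | Var2 v => Var (var_of v : var (ctx_of G) N)
  | Zero2 => `0
  | One2 => `1
  | Add2 a b => tm_of a +' tm_of b
  | Mul2 a b => tm_of a *' tm_of b
  end.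

Definition is_char (G : list ty) (f : tm G ty1) : fm G :=
  All N (twk N f @ #0 =' `0 \/' twk N f @ #0 =' `1).

Definition all_of (s : sort) (G : list ty) : fm (ty_of_sort s :: G) -> fm G :=
  match s with
  | Num => fun A => All N A
  | Set_ => fun A => All ty1 (is_char #0 -->' A)
  end.

Definition ex_of (s : sort) (G : list ty) : fm (ty_of_sort s :: G) -> fm G :=
  match s with
  | Num => fun A => Ex N A
  | Set_ => fun A => Ex ty1 (is_char #0 /\' A)
  end.

Fixpoint fm_of (G : list sort) (A : fm2 G) : fm (ctx_of G) :=
  match A in fm2 G0 return fm (ctx_of G0) with
  | Eq2 a b => tm_of a =' tm_of b
  | Lt2 a b => tm_of a <' tm_of b
  | @Mem2 G0 a X => Var (var_of X : var (ctx_of G0) ty1) @ tm_of a =' `1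
  | Bot2 => Bot
  | Imp2 A B => fm_of A -->' fm_of B
  | And2 A B => fm_of A /\' fm_of B
  | Or2 A B => fm_of A \/' fm_of B
  | @All2 _ s A => @all_of s _ (fm_of A)
  | @Ex2 _ s A => @ex_of s _ (fm_of A)
  end.

Definition proves2 (T : theory) (S : fm2 [] -> Prop) : Prop :=
  forall A : fm2 [], S A -> proves T (fm_of A).

(* Main.v *)
(** The argument is semantic: by completeness of the calculus it suffices to show that
    every model of the theory satisfies the axioms of [Pi11_CA0], and, as all the
    extensionality axioms are present, only models in which extensionally equal elements
    are equal need to be considered.

    In such a model [mu] decides arithmetical formulas.  Skolemizing inside the model
    gives every arithmetical [P x n] the form [exists g, forall m, R x g n m] with [R]
    continuous in [x] and [g], with a definable modulus of continuity, and with a witness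
    [g] definable from [x].  Code [n], [x] and [g] into a single function [f], and let
    [Psi f] be so large that, if [f] fails to satisfy [forall m, R x g n m], the whole
    neighbourhood of [f] given by [Psi f] fails for the same [m].  If [P x n] holds for
    some [x], a correct code for [n] lies in the neighbourhood of some member of the
    Lindelof sequence, which must then itself be a correct code.  Hence
    [exists x, P x n] holds iff some member of the sequence is a correct code for [n],
    which is arithmetical. *)

From Stdlib Require Import List Arith Lia FunctionalExtensionality.
From Stdlib Require Import PropExtensionality ClassicalEpsilon Cantor Program.Equality.
Require Import Defs.
Import ListNotations.

Set Implicit Arguments.
Unset Strict Implicit.
Unset Printing Implicit Defensive.

(** * Substitution *)

(** The models are arbitrary: their numbers may be nonstandard, and a function of the metatheory
    need not be represented in them. So every functional handed to the model, above all [Psi] and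
    the moduli inside it, has to be given by a term with parameters. [dfn] and [dpr] record this,
    and induction and least-number arguments are available only for predicates of this kind. The
    theory chooses numbers for functions but not functions for numbers. A sequence of witness
    functions, as needed at a universal number quantifier, must therefore be an explicit term; this
    forces a definable witness at an existential quantifier too, where the least number is taken.
    Closed representations do not pass to negations, so a predicate and its negation are carried
    through the induction on formulas together. On the syntactic side the constants are fixed once
    and for all, so Henkin witnesses are fresh variables, and the model is assembled from a growing
    chain of contexts. *)

Lemma var_nil_elim (A : Type) (s : A) (P : var [] s -> Prop) (v : var [] s) : P v.
Proof.
  refine (match v as v0 in var L s0
            return match L return var L s0 -> Prop with
                   | [] => fun v0 => forall P : var [] s0 -> Prop, P v0
                   | _ :: _ => fun _ => True
                   end v0
          with V0 => I | VS _ => I end P).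
Qed.

Lemma var_cons_ind (A : Type) (r : A) (G : list A)
    (P : forall s, var (r :: G) s -> Prop) :
  P r V0 -> (forall s (v : var G s), P s (VS v)) -> forall s v, P s v.
Proof.
  intros H0 HS s v.
  refine (match v as v0 in var L s0
            return match L return var L s0 -> Prop with
                   | [] => fun _ => True
                   | r' :: G' => fun v0 => forall P : forall s, var (r' :: G') s -> Prop,
                       P r' V0 -> (forall s w, P s (VS w)) -> P s0 v0
                   end v0
          with V0 => _ | VS w => _ end P H0 HS); auto.
Qed.

Lemma subst_ext (X : ty -> Type) (r : ty) (G : list ty) (f g : forall s, var (r :: G) s -> X s) :
  f r V0 = g r V0 -> (forall s v, f s (VS v) = g s (VS v)) -> f = g.
Proof.
  intros H0 HS.
  apply functional_extensionality_dep; intro s; apply functional_extensionality; intro v.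
  revert s v; apply var_cons_ind; auto.
Qed.

Lemma subst_nil_ext (X : ty -> Type) (f g : forall s, var [] s -> X s) : f = g.
Proof.
  apply functional_extensionality_dep; intro s; apply functional_extensionality; intro v.
  apply (var_nil_elim (fun v => f s v = g s v)).
Qed.

Lemma fun2_ext (X : ty -> Type) (G : list ty) (f g : forall s, var G s -> X s) :
  (forall s v, f s v = g s v) -> f = g.
Proof.
  intro H.
  apply functional_extensionality_dep; intro s; apply functional_extensionality; auto.
Qed.

Definition comp (G D E : list ty) (f : subst G D) (g : subst D E) : subst G E :=
  fun s v => tsub g (f s v).

Lemma tsub_tsub (G D E : list ty) (f : subst G D) (g : subst D E) s (a : tm G s) :
  tsub g (tsub f a) = tsub (comp f g) a.
Proof. induction a; simpl; [reflexivity | reflexivity | congruence]. Qed.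

Lemma tsub_ids (G : list ty) s (a : tm G s) : tsub (@ids G) a = a.
Proof. induction a; simpl; [reflexivity | reflexivity | congruence]. Qed.

Lemma up_ids (G : list ty) r : up (@ids G) = @ids (r :: G).
Proof. apply subst_ext; reflexivity. Qed.

Lemma tsub_up_shift (G D : list ty) r (f : subst G D) s (a : tm G s) :
  tsub (up f) (tsub (@shift G r) a) = tsub (@shift D r) (tsub f a).
Proof. rewrite !tsub_tsub; reflexivity. Qed.

Lemma up_comp (G D E : list ty) r (f : subst G D) (g : subst D E) :
  up (r := r) (comp f g) = comp (up f) (up g).
Proof.
  apply subst_ext; [reflexivity|]; intros s v.
  unfold comp; simpl; rewrite tsub_up_shift; reflexivity.
Qed.

Lemma fsub_fsub (G : list ty) (A : fm G) :
  forall (D E : list ty) (f : subst G D) (g : subst D E),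
  fsub (fsub A f) g = fsub A (comp f g).
Proof.
  induction A; intros D E f g; simpl;
    rewrite ?tsub_tsub, ?IHA1, ?IHA2, ?up_comp, ?IHA; reflexivity.
Qed.

Lemma fsub_ids (G : list ty) (A : fm G) : fsub A (@ids G) = A.
Proof.
  induction A; simpl; rewrite ?tsub_ids, ?up_ids, ?IHA1, ?IHA2, ?IHA; reflexivity.
Qed.

Lemma fsub_inst (G D : list ty) r (A : fm (r :: G)) (a : tm G r) (f : subst G D) :
  fsub (inst A a) f = inst (fsub A (up f)) (tsub f a).
Proof.
  unfold inst; rewrite !fsub_fsub; f_equal.
  apply subst_ext; [reflexivity|]; intros s v.
  unfold comp; simpl; rewrite tsub_tsub; symmetry; apply tsub_ids.
Qed.

Lemma inst_up (G D : list ty) r (A : fm (r :: G)) (f : subst G D) (a : tm D r) :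
  inst (fsub A (up f)) a = fsub A (scons a f).
Proof.
  unfold inst; rewrite !fsub_fsub; f_equal.
  apply subst_ext; [reflexivity|]; intros s v.
  unfold comp; simpl; rewrite tsub_tsub; apply tsub_ids.
Qed.

Lemma fsub_wk (G D : list ty) r (A : fm G) (f : subst G D) :
  fsub (wk r A) (up f) = wk r (fsub A f).
Proof. unfold wk; rewrite !fsub_fsub; reflexivity. Qed.

Lemma inst_wk (G : list ty) r (A : fm G) (a : tm G r) : inst (wk r A) a = A.
Proof. unfold inst, wk; rewrite fsub_fsub; apply fsub_ids. Qed.

Lemma map_wk_fsub (G D : list ty) r (f : subst G D) (L : list (fm G)) :
  map (fun B => fsub B (up f)) (map (wk r) L) = map (wk r) (map (fun B => fsub B f) L).
Proof. rewrite !map_map; apply map_ext; intro B; apply fsub_wk. Qed.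

(** * Structural properties of derivations *)

Lemma prv_weaken (T : theory) (G : list ty) (D : list (fm G)) (A : fm G) :
  prv T D A -> forall D', incl D D' -> prv T D' A.
Proof.
  assert (C : forall (G : list ty) (D D' : list (fm G)) A,
            incl D D' -> incl (A :: D) (A :: D')).
  { intros G' L L' B H; apply incl_cons; [left; reflexivity | apply incl_tl, H]. }
  induction 1; intros D' H'.
  - apply prv_ax; assumption.
  - apply prv_hyp; auto.
  - apply prv_raa; auto.
  - apply prv_impI; auto.
  - eapply prv_impE; eauto.
  - apply prv_andI; auto.
  - eapply prv_andE1; eauto.
  - eapply prv_andE2; eauto.
  - apply prv_orI1; auto.
  - apply prv_orI2; auto.
  - eapply prv_orE; eauto.
  - apply prv_allI, IHprv, incl_map, H'.
  - apply prv_allE; auto.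
  - eapply prv_exI; eauto.
  - eapply prv_exE; [apply IHprv1, H' | apply IHprv2, C, incl_map, H'].
  - apply prv_eqI.
  - eapply prv_eqE; eauto.
Qed.

Lemma prv_fsub (T : theory) (G : list ty) (D : list (fm G)) (A : fm G) :
  prv T D A -> forall (E : list ty) (f : subst G E),
  prv T (map (fun B => fsub B f) D) (fsub A f).
Proof.
  induction 1; intros E f; simpl in *.
  - rewrite fsub_fsub.
    rewrite (subst_nil_ext (comp (@from_nil G) f) (@from_nil E)).
    apply prv_ax; assumption.
  - apply prv_hyp; exact (in_map (fun B => fsub B f) _ _ H).
  - apply prv_raa, IHprv.
  - apply prv_impI, IHprv.
  - eapply prv_impE; [apply IHprv1 | apply IHprv2].
  - apply prv_andI; auto.
  - eapply prv_andE1; eauto.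
  - eapply prv_andE2; eauto.
  - apply prv_orI1; auto.
  - apply prv_orI2; auto.
  - eapply prv_orE; [apply IHprv1 | apply IHprv2 | apply IHprv3].
  - apply prv_allI; rewrite <- map_wk_fsub; apply IHprv.
  - rewrite fsub_inst; apply prv_allE, IHprv.
  - apply prv_exI with (tsub f a); rewrite <- fsub_inst; apply IHprv.
  - eapply prv_exE; [apply IHprv1 |].
    rewrite <- map_wk_fsub, <- fsub_wk; apply IHprv2.
  - apply prv_eqI.
  - rewrite fsub_inst; eapply prv_eqE; [apply IHprv1 |].
    rewrite <- fsub_inst; apply IHprv2.
Qed.

Lemma prv_cut (T : theory) (G : list ty) (D : list (fm G)) (A B : fm G) :
  prv T D A -> prv T (A :: D) B -> prv T D B.
Proof. intros HA HB; eapply prv_impE; [apply prv_impI, HB | exact HA]. Qed.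

Lemma prv_exfalso (T : theory) (G : list ty) (D : list (fm G)) (A : fm G) :
  prv T D Bot -> prv T D A.
Proof. intro H; apply prv_raa, (prv_weaken H), incl_tl, incl_refl. Qed.

(** * Countability of the language *)

Definition code3 (k a b : nat) : nat := to_nat (k, to_nat (a, b)).

Lemma code3_inj k a b k' a' b' :
  code3 k a b = code3 k' a' b' -> k = k' /\ a = a' /\ b = b'.
Proof.
  unfold code3; intro H; apply to_nat_inj, pair_equal_spec in H; destruct H as [H H1].
  apply to_nat_inj, pair_equal_spec in H1; tauto.
Qed.

Global Opaque code3.

Fixpoint ty_code (s : ty) : nat :=
  match s with
  | N => code3 0 0 0
  | Arr r t => code3 1 (ty_code r) (ty_code t)
  end.

Ltac code_inj H := apply code3_inj in H; destruct H as [? [? ?]]; try discriminate.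

Lemma ty_code_inj s : forall t, ty_code s = ty_code t -> s = t.
Proof.
  induction s; intros [|t1 t2] H; simpl in H; code_inj H; auto.
  f_equal; auto.
Qed.

Fixpoint var_code (G : list ty) s (v : var G s) : nat :=
  match v with V0 => 0 | VS w => S (var_code w) end.

(** In a fixed context the index alone determines the sort. The conclusion equates dependent pairs
    because the two sorts are not known to agree beforehand. *)
Lemma var_code_inj (G : list ty) s (v : var G s) :
  forall s' (v' : var G s'), var_code v = var_code v' -> existT _ s v = existT _ s' v'.
Proof.
  induction v.
  - apply (var_cons_ind (P := fun s' v' => var_code V0 = var_code v' ->
                                existT _ s V0 = existT _ s' v')); auto.
    intros; discriminate.
  - apply (var_cons_ind (P := fun s' v' => var_code (VS v) = var_code v' ->
                                existT _ s (VS v) = existT _ s' v')); [discriminate|].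
    simpl; intros s' v' H.
    assert (E := IHv s' v' ltac:(congruence)).
    dependent destruction E; reflexivity.
Qed.

Definition const_code s (c : const s) : nat :=
  match c with
  | cZero => code3 0 0 0
  | cOne => code3 1 0 0
  | cAdd => code3 2 0 0
  | cMul => code3 3 0 0
  | cK r s => code3 4 (ty_code r) (ty_code s)
  | cS r s t => code3 5 (ty_code r) (code3 0 (ty_code s) (ty_code t))
  | cR s => code3 6 0 (ty_code s)
  end.

Lemma const_code_inj s (c : const s) s' (c' : const s') :
  const_code c = const_code c' -> existT _ s c = existT _ s' c'.
Proof.
  destruct c, c'; simpl; intro H; code_inj H; auto.
  - apply ty_code_inj in H0, H1; subst; reflexivity.
  - code_inj H1; apply ty_code_inj in H0, H2, H3; subst; reflexivity.
  - apply ty_code_inj in H1; subst; reflexivity.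
Qed.

Fixpoint tm_code (G : list ty) s (a : tm G s) : nat :=
  match a with
  | Var v => code3 0 0 (var_code v)
  | Cst c => code3 1 0 (const_code c)
  | App b c => code3 2 (tm_code b) (tm_code c)
  end.

(** The code of an application omits the argument type; it is recovered from the type of the coded
    function, which the dependent pair in the induction hypothesis supplies. *)
Lemma tm_code_inj (G : list ty) s (a : tm G s) :
  forall s' (a' : tm G s'), tm_code a = tm_code a' -> existT _ s a = existT _ s' a'.
Proof.
  induction a; intros s' a'; destruct a'; simpl; intro H; code_inj H.
  - apply var_code_inj in H1; dependent destruction H1; reflexivity.
  - apply const_code_inj in H1; dependent destruction H1; reflexivity.
  - apply IHa1 in H0; apply IHa2 in H1.
    dependent destruction H0; dependent destruction H1; reflexivity.
Qed.

Fixpoint fm_code (G : list ty) (A : fm G) : nat :=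
  match A with
  | Eq0 a b => code3 0 (tm_code a) (tm_code b)
  | Lt0 a b => code3 1 (tm_code a) (tm_code b)
  | Bot => code3 2 0 0
  | Imp A B => code3 3 (fm_code A) (fm_code B)
  | And A B => code3 4 (fm_code A) (fm_code B)
  | Or A B => code3 5 (fm_code A) (fm_code B)
  | All s A => code3 6 (ty_code s) (fm_code A)
  | Ex s A => code3 7 (ty_code s) (fm_code A)
  end.

Lemma fm_code_inj (G : list ty) (A : fm G) : forall B : fm G, fm_code A = fm_code B -> A = B.
Proof.
  induction A; intro B; dependent destruction B; simpl; intro H; code_inj H; auto;
    try (apply tm_code_inj in H0, H1; dependent destruction H0; dependent destruction H1;
         reflexivity);
    try (apply IHA1 in H0; apply IHA2 in H1; subst; reflexivity);
    apply ty_code_inj in H0; subst; apply IHA in H1; subst; reflexivity.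
Qed.

Definition enum (G : list ty) (c : nat) : fm G :=
  epsilon (inhabits Bot) (fun A : fm G => fm_code A = c).

Lemma enum_surj (G : list ty) (A : fm G) : enum G (fm_code A) = A.
Proof.
  apply fm_code_inj.
  apply (epsilon_spec (inhabits (@Bot G)) (fun B => fm_code B = fm_code A)).
  exists A; reflexivity.
Qed.

(** * Structures *)

(** Kept apart from the relations because terms must be evaluated in the term algebra before
    equality and order of the term model can be defined. *)
Record algebra := {
  car : ty -> Type;
  cst : forall s, const s -> car s;
  app : forall s t, car (s ~> t) -> car s -> car t
}.

Record structure := {
  alg :> algebra;
  eq0 : car alg N -> car alg N -> Prop;
  lt0 : car alg N -> car alg N -> Prop
}.

Definition valuation (M : algebra) (G : list ty) : Type := forall s, var G s -> car M s.

Definition vcons (X : ty -> Type) (r : ty) (G : list ty) (a : X r) (e : forall s, var G s -> X s) :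
    forall s, var (r :: G) s -> X s :=
  fun s v =>
    match v in var G0 s0
      return match G0 with
             | [] => unit
             | r' :: G' => X r' -> (forall s, var G' s -> X s) -> X s0
             end
    with
    | V0 => fun a' _ => a'
    | VS w => fun _ e' => e' _ w
    end a e.

Definition vnil (X : ty -> Type) : forall s, var [] s -> X s :=
  fun s v => match v in var G0 s0
               return match G0 with [] => X s0 | _ :: _ => unit end
             with V0 => tt | VS _ => tt end.

Fixpoint teval (M : algebra) (G : list ty) s (a : tm G s) (e : valuation M G) : car M s :=
  match a with
  | Var v => e _ v
  | Cst c => cst M c
  | App b c => app (teval b e) (teval c e)
  end.

Fixpoint sat (M : structure) (G : list ty) (A : fm G) : valuation M G -> Prop :=
  match A in fm G0 return valuation M G0 -> Prop with
  | Eq0 a b => fun e => eq0 (teval a e) (teval b e)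
  | Lt0 a b => fun e => lt0 (teval a e) (teval b e)
  | Bot => fun _ => False
  | Imp A B => fun e => @sat M _ A e -> @sat M _ B e
  | And A B => fun e => @sat M _ A e /\ @sat M _ B e
  | Or A B => fun e => @sat M _ A e \/ @sat M _ B e
  | All s A => fun e => forall x : car M s, @sat M _ A (vcons x e)
  | Ex s A => fun e => exists x : car M s, @sat M _ A (vcons x e)
  end.

Definition models (M : structure) (A : fm []) : Prop := sat A (vnil (car M)).

Lemma teval_tsub (M : algebra) (G D : list ty) (f : subst G D) s (a : tm G s) (e : valuation M D) :
  teval (tsub f a) e = teval a (fun s v => teval (f s v) e).
Proof. induction a; simpl; [reflexivity | reflexivity | congruence]. Qed.

Lemma vcons_up (M : algebra) (G D : list ty) r (f : subst G D) (x : car M r) (e : valuation M D) :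
  (fun s v => teval (up f v) (vcons x e)) = vcons x (fun s v => teval (f s v) e).
Proof.
  apply subst_ext; [reflexivity|]; intros s v; simpl.
  rewrite teval_tsub; reflexivity.
Qed.

Lemma sat_fsub (M : structure) (G : list ty) (A : fm G) :
  forall (D : list ty) (f : subst G D) (e : valuation M D),
  sat (fsub A f) e <-> sat A (fun s v => teval (f s v) e).
Proof.
  induction A; intros D f e; simpl; rewrite ?teval_tsub, ?IHA1, ?IHA2; try tauto.
  - split; intros H x; specialize (H x); apply IHA in H || apply IHA;
      rewrite vcons_up in *; exact H.
  - split; intros [x H]; exists x; apply IHA in H || apply IHA;
      rewrite vcons_up in *; exact H.
Qed.

(** * Henkin completeness *)

Section Henkin.

Variable T : theory.

Definition consistent (G : list ty) (D : list (fm G)) : Prop := ~ prv T D Bot.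

(* [B] is decided by the new hypotheses, with a witness if it is an existential
   formula that is accepted. *)
Definition henkin_step (G : list ty) (D : list (fm G)) (B : fm G)
    (p : {s : ty & list (fm (s :: G))}) : Prop :=
  consistent D ->
  consistent (projT2 p) /\
  incl (map (wk (projT1 p)) D) (projT2 p) /\
  (prv T (projT2 p) (wk _ (~' B)) \/
   prv T (projT2 p) (wk _ B) /\
   forall s A, B = Ex s A ->
     exists a, prv T (projT2 p) (inst (fsub A (up (@shift G (projT1 p)))) a)).

(** Instantiating the fresh variable by the closed term [0] turns a contradiction in the larger
    context into one in the smaller. *)
Lemma consistent_wk (G : list ty) (D : list (fm G)) :
  consistent D -> consistent (map (wk N) D).
Proof.
  intros HD H; apply HD.
  assert (H' := prv_fsub H (scons `0 (@ids G))); simpl in H'.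
  rewrite map_map in H'.
  rewrite (map_ext _ (fun B => B)), map_id in H'; [exact H'|].
  intro B; apply inst_wk.
Qed.

Lemma henkin_step_ex (G : list ty) (D : list (fm G)) (B : fm G) :
  exists p, henkin_step D B p.
Proof.
  destruct (classic (prv T (B :: D) Bot)) as [HB | HB].
  (* No witness is called for here; a dummy variable of type [N] is added so that every stage
     extends the context by exactly one variable. *)
  { exists (existT _ N (map (wk N) ((~' B) :: D))).
    intro HD; simpl; split; [|split; [|left]].
    - apply (@consistent_wk _ ((~' B) :: D)); intro H.
      apply HD; eapply prv_cut; [|exact H].
      apply prv_impI, HB.
    - intros A HA; right; exact HA.
    - apply prv_hyp; left; reflexivity. }
  destruct (classic (exists s A, B = Ex s A)) as [(s & A & ->) | HE].
  (* The new variable is the witness: read in the extended context, the matrix [A] is the hypothesis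
     about it, and [prv_exE] gives consistency. *)
  - exists (existT _ s (A :: map (wk s) (Ex s A :: D))).
    intro HD; unfold consistent; cbn [projT1 projT2]; split; [|split; [|right; split]].
    + intro H; apply HB.
      eapply prv_exE with (A := A); [apply prv_hyp; left; reflexivity | exact H].
    + intros C HC; right; right; exact HC.
    + apply prv_hyp; right; left; reflexivity.
    + intros s' A' E; dependent destruction E.
      exists #0; rewrite inst_up.
      apply prv_hyp; left; rewrite <- (fsub_ids A') at 1; f_equal.
      apply subst_ext; reflexivity.
  - exists (existT _ N (map (wk N) (B :: D))).
    intro HD; simpl; split; [|split; [|right; split]].
    + apply (@consistent_wk _ (B :: D)), HB.
    + intros A HA; right; exact HA.
    + apply prv_hyp; left; reflexivity.
    + intros s A E; destruct HE; eauto.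
Qed.

(** * The chain of contexts and hypotheses *)

Definition embedding (D : list ty) : Type := {G : list ty & subst G D}.
Definition embed (G D : list ty) (f : subst G D) : embedding D :=
  existT (fun G => subst G D) G f.

Definition next (G : list ty) (D : list (fm G)) (B : fm G) : {s : ty & list (fm (s :: G))} :=
  proj1_sig (constructive_indefinite_description _ (henkin_step_ex D B)).

Lemma next_spec (G : list ty) (D : list (fm G)) (B : fm G) : henkin_step D B (next D B).
Proof. exact (proj2_sig (constructive_indefinite_description _ (henkin_step_ex D B))). Qed.

(* Besides the current context and hypotheses, a state records the earlier
   contexts together with their embeddings into the current one. *)
Record state := {
  st_ctx : list ty;
  st_hyps : list (fm st_ctx);
  st_past : nat -> embedding st_ctx
}.

Variable A0 : fm [].

(* At stage [n = to_nat (k, c)] the formula with code [c] in the context of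
   stage [k <= n] is treated. *)
Definition task_of (S : state) (k c : nat) : fm (st_ctx S) :=
  fsub (enum (projT1 (st_past S k)) c) (projT2 (st_past S k)).

Definition task (n : nat) (S : state) : fm (st_ctx S) :=
  task_of S (fst (of_nat n)) (snd (of_nat n)).

Definition next_at (n : nat) (S : state) : {s : ty & list (fm (s :: st_ctx S))} :=
  next (st_hyps S) (task n S).

(** At stage [n] only the indices [k <= n] of [st_past] refer to earlier stages; the others hold the
    embedding of the empty context as a placeholder until their stage is reached. *)
Fixpoint st (n : nat) : state :=
  match n with
  | 0 => {| st_ctx := []; st_hyps := [~' A0]; st_past := fun _ => embed (@ids []) |}
  | S m =>
      {| st_ctx := projT1 (next_at m (st m)) :: st_ctx (st m);
         st_hyps := projT2 (next_at m (st m));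
         st_past := fun k =>
           if k =? S m then embed (@ids _)
           else embed
                  (comp (projT2 (st_past (st m) k)) (@shift _ _)) |}
  end.

Definition ctx (n : nat) : list ty := st_ctx (st n).
Definition hyps (n : nat) : list (fm (ctx n)) := st_hyps (st n).
Definition sort_at (n : nat) : ty := projT1 (next_at n (st n)).

(** Variables are named by the stage that introduces them instead of by a de Bruijn index, so that
    the terms of all the contexts live in one family. *)
Inductive gtm : ty -> Type :=
| gvar : forall n, gtm (sort_at n)
| gcst : forall s, const s -> gtm s
| gapp : forall s t, gtm (s ~> t) -> gtm s -> gtm t.

Definition term_algebra : algebra := {| car := gtm; cst := gcst; app := gapp |}.

Fixpoint gv (n : nat) : valuation term_algebra (ctx n) :=
  match n return valuation term_algebra (ctx n) with
  | 0 => vnil gtm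
  | S m => vcons (gvar m) (@gv m)
  end.
Arguments gv n [s] v.

Definition glob (n : nat) s (a : tm (ctx n) s) : gtm s := teval a (gv n).

(** The index [sort_at n] of [gvar] is not in constructor form, so equations between global terms do
    not invert well; equations between their codes do. *)
Fixpoint gcode s (a : gtm s) : nat :=
  match a with
  | gvar n => code3 0 0 n
  | gcst c => code3 1 0 (const_code c)
  | gapp a b => code3 2 (gcode a) (gcode b)
  end.

Lemma gv_code n s (v : var (ctx n) s) : exists k, k < n /\ gcode (gv n v) = code3 0 0 k.
Proof.
  revert s v; induction n as [|n IH].
  - intros s v; apply (var_nil_elim (fun v => exists k, k < 0 /\ gcode (gv 0 v) = code3 0 0 k)).
  - apply var_cons_ind.
    + exists n; auto.
    + intros s v; destruct (IH _ v) as (k & Hk & E); exists k; auto.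
Qed.

Lemma gv_inj n : forall s (v : var (ctx n) s) s' (v' : var (ctx n) s'),
  gcode (gv n v) = gcode (gv n v') -> existT _ s v = existT _ s' v'.
Proof.
  induction n as [|n IH].
  - intros s v; apply (var_nil_elim (fun v => forall s' (v' : var (ctx 0) s'),
      gcode (gv 0 v) = gcode (gv 0 v') -> existT _ s v = existT _ s' v')).
  - assert (F : forall s (v : var (ctx n) s), code3 0 0 n <> gcode (gv n v)).
    { intros s v H; destruct (gv_code v) as (k & Hk & E); rewrite E in H; code_inj H; lia. }
    apply (var_cons_ind (P := fun s v => forall s' (v' : var (ctx (S n)) s'),
      gcode (gv (S n) v) = gcode (gv (S n) v') -> existT _ s v = existT _ s' v')).
    + apply (var_cons_ind (P := fun s' v' =>
        gcode (gv (S n) V0) = gcode (gv (S n) v') -> existT _ _ V0 = existT _ s' v')); auto.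
      intros s v H; destruct (F _ _ H).
    + intros s w.
      apply (var_cons_ind (P := fun s' v' =>
        gcode (gv (S n) (VS w)) = gcode (gv (S n) v') -> existT _ _ (VS w) = existT _ s' v')).
      * intro H; destruct (F _ w); symmetry; exact H.
      * intros s' w' H; assert (E := IH _ w _ w' H).
        dependent destruction E; reflexivity.
Qed.

Lemma glob_inj_dep n s (a : tm (ctx n) s) : forall s' (a' : tm (ctx n) s'),
  gcode (glob a) = gcode (glob a') -> existT _ s a = existT _ s' a'.
Proof.
  unfold glob.
  induction a; intros s' a'; destruct a'; simpl; intro H;
    try (destruct (gv_code v) as (k & _ & E); rewrite E in H; code_inj H; fail);
    try (destruct (gv_code v0) as (k & _ & E); rewrite E in H; code_inj H; fail);
    try (code_inj H; fail).
  - apply gv_inj in H; dependent destruction H; reflexivity.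
  - code_inj H; apply const_code_inj in H1; dependent destruction H1; reflexivity.
  - code_inj H; apply IHa1 in H0; apply IHa2 in H1.
    dependent destruction H0; dependent destruction H1; reflexivity.
Qed.

Lemma glob_inj n s (a a' : tm (ctx n) s) : glob a = glob a' -> a = a'.
Proof.
  intro H; apply inj_pair2 with (P := fun s => tm (ctx n) s).
  apply glob_inj_dep; rewrite H; reflexivity.
Qed.

(** The inclusion of an earlier context into a later one, characterized by its keeping the global
    name of every variable rather than by how it was built. *)
Definition lifting (k n : nat) (f : subst (ctx k) (ctx n)) : Prop :=
  forall s v, glob (f s v) = gv k v.

Lemma glob_lifting k n (f : subst (ctx k) (ctx n)) s (a : tm (ctx k) s) :
  lifting f -> glob (tsub f a) = glob a.
Proof.
  intro H; unfold glob; rewrite teval_tsub; f_equal.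
  apply fun2_ext; exact H.
Qed.

Lemma lifting_ids k : lifting (@ids (ctx k)).
Proof. intros s v; reflexivity. Qed.

Lemma lifting_comp k n m (f : subst (ctx k) (ctx n)) (g : subst (ctx n) (ctx m)) :
  lifting f -> lifting g -> lifting (comp f g).
Proof.
  intros Hf Hg s v; unfold comp; rewrite glob_lifting by assumption; apply Hf.
Qed.

(** A term is determined by its global name within a stage. Hence formulas carried to a common stage
    along different routes coincide. *)
Lemma lifting_uniq k n (f g : subst (ctx k) (ctx n)) : lifting f -> lifting g -> f = g.
Proof.
  intros Hf Hg; apply fun2_ext; intros s v; apply glob_inj; congruence.
Qed.

Lemma lifting_shift n : lifting (@shift (ctx n) (sort_at n) : subst (ctx n) (ctx (S n))).
Proof. intros s v; reflexivity. Qed.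

Hypothesis A0_unprovable : ~ prv T [] A0.

Lemma hyps_step n : henkin_step (hyps n) (task n (st n)) (existT _ (sort_at n) (hyps (S n))).
Proof.
  unfold hyps, sort_at; simpl; rewrite <- sigT_eta; apply next_spec.
Qed.

Lemma hyps_consistent n : consistent (hyps n).
Proof.
  induction n as [|n IH].
  - intro H; apply A0_unprovable, prv_raa, H.
  - apply (hyps_step IH).
Qed.

Lemma past_lifting k n : k <= n -> exists f : subst (ctx k) (ctx n),
  st_past (st n) k = embed f /\ lifting f /\
  forall B, prv T (hyps k) B -> prv T (hyps n) (fsub B f).
Proof.
  intro Hkn.
  assert (R : exists f : subst (ctx n) (ctx n),
    st_past (st n) n = embed f /\ lifting f /\
    forall B, prv T (hyps n) B -> prv T (hyps n) (fsub B f)).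
  { exists (@ids _); split; [|split].
    - destruct n; simpl; [|rewrite Nat.eqb_refl]; reflexivity.
    - apply lifting_ids.
    - intros B; rewrite fsub_ids; auto. }
  induction n as [|n IH].
  - replace k with 0 by lia; exact R.
  - destruct (Nat.eq_dec k (S n)) as [-> | Hk]; [exact R|]; clear R.
    destruct IH as (f & E & Hf & HB); [lia| |].
    { exists (@ids _); split; [|split].
      - destruct n; simpl; [|rewrite Nat.eqb_refl]; reflexivity.
      - apply lifting_ids.
      - intros B; rewrite fsub_ids; auto. }
    exists (comp f (@shift (ctx n) (sort_at n))); split; [|split].
    + simpl; apply Nat.eqb_neq in Hk; rewrite Hk, E; reflexivity.
    + apply (lifting_comp (m := S n)); [exact Hf | apply lifting_shift].
    + intros B H; rewrite <- fsub_fsub.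
      eapply prv_weaken; [apply prv_fsub, HB, H|].
      apply (hyps_step (@hyps_consistent n)).
Qed.

Lemma lifting_ex k n : k <= n -> exists f : subst (ctx k) (ctx n), lifting f.
Proof. intro H; destruct (past_lifting H) as (f & _ & Hf & _); eauto. Qed.

Lemma prv_lifting k n (f : subst (ctx k) (ctx n)) B :
  k <= n -> lifting f -> prv T (hyps k) B -> prv T (hyps n) (fsub B f).
Proof.
  intros H Hf; destruct (past_lifting H) as (g & _ & Hg & HB).
  rewrite (lifting_uniq Hf Hg); apply HB.
Qed.

(** Truth in the limit of the chain: [hyps k] itself need not decide [B], but some later stage
    does. *)
Definition holds (k : nat) (B : fm (ctx k)) : Prop :=
  exists n (f : subst (ctx k) (ctx n)), k <= n /\ lifting f /\ prv T (hyps n) (fsub B f).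

Lemma holds_lifting k m (f : subst (ctx k) (ctx m)) B :
  k <= m -> lifting f -> holds (fsub B f) <-> holds B.
Proof.
  intros Hkm Hf; split.
  - intros (n & g & Hn & Hg & H); exists n, (comp f g).
    split; [lia|split]; [apply lifting_comp; assumption|].
    rewrite <- fsub_fsub; exact H.
  - intros (n & g & Hn & Hg & H).
    destruct (lifting_ex (Nat.le_max_l m n)) as [h Hh].
    destruct (lifting_ex (Nat.le_max_r m n)) as [h' Hh'].
    exists (max m n), h; split; [lia|split]; [assumption|].
    rewrite fsub_fsub.
    rewrite (lifting_uniq (lifting_comp Hf Hh) (lifting_comp Hg Hh')).
    rewrite <- fsub_fsub; apply prv_lifting; auto; lia.
Qed.

Lemma holds_prv k B : prv T (hyps k) B -> holds B.
Proof.
  intro H; exists k, (@ids _); split; [lia|split]; [apply lifting_ids|].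
  rewrite fsub_ids; exact H.
Qed.

Lemma holds_Bot k : ~ holds (k := k) Bot.
Proof. intros (n & f & _ & _ & H); exact (hyps_consistent H). Qed.

(** The premises, derivable at two different stages, are moved to a common one. Each connective then
    needs only a short derivation. *)
Lemma holds_trans k (A B C : fm (ctx k)) :
  prv T [A; B] C -> holds A -> holds B -> holds C.
Proof.
  intros H (n & f & Hn & Hf & HA) (m & g & Hm & Hg & HB).
  destruct (lifting_ex (Nat.le_max_l n m)) as [h Hh].
  destruct (lifting_ex (Nat.le_max_r n m)) as [h' Hh'].
  exists (max n m), (comp f h); split; [lia|split]; [apply lifting_comp; assumption|].
  apply (prv_lifting (Nat.le_max_l n m) Hh) in HA.
  apply (prv_lifting (Nat.le_max_r n m) Hh') in HB.
  rewrite fsub_fsub in HA, HB.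
  rewrite (lifting_uniq (lifting_comp Hg Hh') (lifting_comp Hf Hh)) in HB.
  eapply prv_cut; [exact HB|]; eapply prv_cut; [eapply prv_weaken; [exact HA|]|].
  - apply incl_tl, incl_refl.
  - eapply prv_weaken; [apply (prv_fsub H (comp f h))|].
    intros X [<- | [<- | []]]; simpl; auto.
Qed.

Lemma holds_trans1 k (A C : fm (ctx k)) : prv T [A] C -> holds A -> holds C.
Proof.
  intros H HA; apply (holds_trans (A := A) (B := A)); auto.
  apply (prv_weaken H); intros X [<- | []]; simpl; auto.
Qed.

Lemma holds_task k (B : fm (ctx k)) : exists n (f : subst (ctx k) (ctx n)),
  k <= n /\ lifting f /\ task n (st n) = fsub B f.
Proof.
  assert (H : k <= to_nat (k, fm_code B)).
  { assert (H := to_nat_non_decreasing k (fm_code B)); lia. }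
  destruct (past_lifting H) as (f & E & Hf & _).
  exists (to_nat (k, fm_code B)), f; split; [exact H|split]; [exact Hf|].
  unfold task; rewrite cancel_of_to; cbn [fst snd]; unfold task_of; rewrite E; cbn [embed projT1 projT2].
  rewrite enum_surj; reflexivity.
Qed.

Lemma holds_dec k (B : fm (ctx k)) : holds B \/ holds (~' B).
Proof.
  destruct (holds_task B) as (n & f & Hn & Hf & E).
  assert (L : lifting (comp f (@shift (ctx n) (sort_at n)) : subst (ctx k) (ctx (S n)))).
  { apply (lifting_comp (m := S n)); [exact Hf | apply lifting_shift]. }
  destruct (hyps_step (@hyps_consistent n)) as (_ & _ & [H | [H _]]);
    rewrite E in H; unfold wk in H; cbn [projT1 projT2] in H; [right | left];
    exists (S n); eexists; (split; [lia | split; [exact L|]]).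
  - rewrite <- fsub_fsub; exact H.
  - rewrite <- fsub_fsub; exact H.
Qed.

Lemma holds_not k (B : fm (ctx k)) : holds (~' B) <-> ~ holds B.
Proof.
  split.
  - intros H1 H2; apply (@holds_Bot k); revert H1 H2; apply holds_trans.
    eapply prv_impE; apply prv_hyp; simpl; auto.
  - destruct (holds_dec B); tauto.
Qed.

Lemma holds_Imp k (A B : fm (ctx k)) : holds (A -->' B) <-> (holds A -> holds B).
Proof.
  split.
  - apply holds_trans; eapply prv_impE; apply prv_hyp; simpl; auto.
  - intro H; destruct (holds_dec A) as [HA | HA].
    + apply H in HA; revert HA; apply holds_trans1, prv_impI, prv_hyp; simpl; auto.
    + revert HA; apply holds_trans1, prv_impI, prv_exfalso.
      eapply prv_impE; apply prv_hyp; simpl; auto.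
Qed.

Lemma holds_And k (A B : fm (ctx k)) : holds (A /\' B) <-> holds A /\ holds B.
Proof.
  split.
  - intro H; split; revert H; apply holds_trans1;
      [eapply prv_andE1 | eapply prv_andE2]; apply prv_hyp; simpl; auto.
  - intros [HA HB]; revert HA HB; apply holds_trans, prv_andI; apply prv_hyp; simpl; auto.
Qed.

Lemma holds_Or k (A B : fm (ctx k)) : holds (A \/' B) <-> holds A \/ holds B.
Proof.
  split.
  - intro H; destruct (classic (holds A)) as [HA | HA]; [auto|].
    right; apply holds_not in HA; revert HA H; apply holds_trans.
    eapply prv_orE; [apply prv_hyp; simpl; auto | | apply prv_hyp; simpl; auto].
    apply prv_exfalso; eapply prv_impE; apply prv_hyp; simpl; auto.
  - intros [H | H]; revert H; apply holds_trans1; [apply prv_orI1 | apply prv_orI2];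
      apply prv_hyp; simpl; auto.
Qed.

Lemma holds_All_inst k s (A : fm (s :: ctx k)) a : holds (All s A) -> holds (inst A a).
Proof. apply holds_trans1, prv_allE, prv_hyp; simpl; auto. Qed.

Lemma holds_Ex_intro k s (A : fm (s :: ctx k)) a : holds (inst A a) -> holds (Ex s A).
Proof. apply holds_trans1, prv_exI with a, prv_hyp; simpl; auto. Qed.

(** At the stage where [Ex s A] is the task it cannot be rejected, being true in the limit; so it is
    accepted, and with a witness. *)
Lemma holds_Ex_elim k s (A : fm (s :: ctx k)) : holds (Ex s A) ->
  exists n (f : subst (ctx k) (ctx n)) a,
    k <= n /\ lifting f /\ holds (inst (fsub A (up f)) a).
Proof.
  intro H; destruct (holds_task (Ex s A)) as (n & f & Hn & Hf & E).
  assert (L : lifting (comp f (@shift (ctx n) (sort_at n)) : subst (ctx k) (ctx (S n)))).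
  { apply (lifting_comp (m := S n)); [exact Hf | apply lifting_shift]. }
  destruct (hyps_step (@hyps_consistent n)) as (_ & _ & [F | [_ F]]); rewrite E in F.
  - apply (holds_prv (k := S n)) in F; apply (holds_lifting _ (Nat.le_succ_diag_r n)) in F;
      [|apply lifting_shift].
    apply holds_not in F; destruct F.
    apply (holds_lifting (Ex s A) Hn Hf), H.
  - destruct (F s _ eq_refl) as [a Ha].
    exists (S n), (comp f (@shift (ctx n) (sort_at n))), a.
    split; [lia|split]; [exact L|].
    rewrite up_comp, <- fsub_fsub; apply (holds_prv (k := S n)), Ha.
Qed.

(** Henkin witnesses exist for existential formulas only, so a false universal formula gets its
    counterexample through the classical duality of the quantifiers. *)
Lemma holds_All_not k s (A : fm (s :: ctx k)) : ~ holds (All s A) -> holds (Ex s (~' A)).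
Proof.
  intro H; apply holds_not in H; revert H; apply holds_trans1.
  apply prv_raa.
  apply prv_impE with (All s A); [apply prv_hyp; simpl; auto|].
  apply prv_allI, prv_raa.
  apply prv_impE with (Ex s (fsub (~' A) (up (@shift (ctx k) s)))).
  - apply prv_hyp; right; left; reflexivity.
  - apply prv_exI with #0; rewrite inst_up.
    replace (scons #0 (@shift (ctx k) s)) with (@ids (s :: ctx k))
      by (apply subst_ext; reflexivity).
    rewrite fsub_ids; apply prv_hyp; left; reflexivity.
Qed.

(** Relations between global terms quantify over the stage, as a global term has no preferred
    context. Equality is still a mere congruence here; the quotient is taken later. *)
Definition term_model : structure := {|
  alg := term_algebra;
  eq0 := fun a b => exists n (a' b' : tm (ctx n) N), glob a' = a /\ glob b' = b /\ holds (a' =' b');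
  lt0 := fun a b => exists n (a' b' : tm (ctx n) N), glob a' = a /\ glob b' = b /\ holds (a' <' b')
|}.

(** The stage can be taken beyond any given [k]; this lets the two parts of an application be
    brought into one context. *)
Lemma glob_surj s (x : gtm s) : forall k, exists n, k <= n /\ exists a : tm (ctx n) s, glob a = x.
Proof.
  induction x; intro k.
  - destruct (lifting_ex (Nat.le_max_r k (S n))) as [f Hf].
    exists (max k (S n)); split; [lia|].
    exists (f _ V0); apply Hf.
  - exists k; split; [lia|]; exists (Cst c); reflexivity.
  - destruct (IHx1 k) as (n & Hn & a & Ha), (IHx2 n) as (m & Hm & b & Hb).
    destruct (lifting_ex Hm) as [f Hf].
    exists m; split; [lia|]; exists (App (tsub f a) b).
    rewrite <- Ha, <- Hb, <- (glob_lifting a Hf); reflexivity.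
Qed.

Lemma holds_atomic (R : forall G, tm G N -> tm G N -> fm G)
    (R_sub : forall G D (f : subst G D) a b, fsub (R G a b) f = R D (tsub f a) (tsub f b))
    n (a b : tm (ctx n) N) :
  (exists m (a' b' : tm (ctx m) N), glob a' = glob a /\ glob b' = glob b /\ holds (R _ a' b'))
  <-> holds (R _ a b).
Proof.
  split; [|eauto 7].
  intros (m & a' & b' & Ea & Eb & H).
  destruct (lifting_ex (Nat.le_max_l n m)) as [h Hh].
  destruct (lifting_ex (Nat.le_max_r n m)) as [h' Hh'].
  apply (holds_lifting _ (Nat.le_max_l n m) Hh).
  apply (holds_lifting _ (Nat.le_max_r n m) Hh') in H.
  rewrite R_sub in *.
  replace (tsub h a) with (tsub h' a') by (apply glob_inj; rewrite !glob_lifting; auto).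
  replace (tsub h b) with (tsub h' b') by (apply glob_inj; rewrite !glob_lifting; auto).
  exact H.
Qed.

(** Stated for substitutions into an arbitrary stage, because an element substituted for a
    quantified variable may be expressible only at a later stage; the assertion [C] moves the matrix
    there before instantiating it. *)
Lemma truth G (A : fm G) : forall n (f : subst G (ctx n)),
  sat (M := term_model) A (fun s v => glob (f s v)) <-> holds (fsub A f).
Proof.
  assert (C : forall G s (A : fm (s :: G)),
    (forall n (f : subst (s :: G) (ctx n)),
      sat (M := term_model) A (fun s v => glob (f s v)) <-> holds (fsub A f)) ->
    forall n m (f : subst G (ctx n)) (g : subst (ctx n) (ctx m)) (a : tm (ctx m) s),
      lifting g ->
      sat (M := term_model) A (vcons (glob a) (fun s v => glob (f s v))) <->
      holds (inst (fsub (fsub A (up f)) (up g)) a)).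
  { intros G' s B IH n m f g a Hg.
    rewrite fsub_fsub, <- up_comp, inst_up, <- IH.
    replace (vcons (glob a) (fun s v => glob (f s v)))
      with (fun t v => glob (scons a (comp f g) (s := t) v)); [reflexivity|].
    apply subst_ext; [reflexivity|]; intros t v; apply (glob_lifting _ Hg). }
  induction A; intros n f; simpl.
  - rewrite <- (holds_atomic (R := Eq0)); [|reflexivity].
    unfold glob; rewrite !teval_tsub; reflexivity.
  - rewrite <- (holds_atomic (R := Lt0)); [|reflexivity].
    unfold glob; rewrite !teval_tsub; reflexivity.
  - split; [intros [] | apply holds_Bot].
  - rewrite holds_Imp, <- IHA1, <- IHA2; reflexivity.
  - rewrite holds_And, <- IHA1, <- IHA2; reflexivity.
  - rewrite holds_Or, <- IHA1, <- IHA2; reflexivity.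
  - specialize (C _ _ _ IHA); split.
    + intro H; apply NNPP; intro F; apply holds_All_not, holds_Ex_elim in F.
      destruct F as (m & g & a & Hm & Hg & F); simpl in F.
      apply (@holds_not m) in F; apply F, C; auto.
    + intros H x; destruct (glob_surj x n) as (m & Hm & a & <-).
      destruct (lifting_ex Hm) as [g Hg].
      apply (C n m f g a Hg), holds_All_inst.
      apply (holds_lifting (All s (fsub A (up f))) Hm Hg), H.
  - specialize (C _ _ _ IHA); split.
    + intros [x H]; destruct (glob_surj x n) as (m & Hm & a & <-).
      destruct (lifting_ex Hm) as [g Hg].
      apply (C n m f g a Hg), holds_Ex_intro in H.
      apply (holds_lifting (Ex s (fsub A (up f))) Hm Hg), H.
    + intro H; apply holds_Ex_elim in H; destruct H as (m & g & a & Hm & Hg & H).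
      exists (glob a); apply (C n m f g a Hg), H.
Qed.

Lemma truth_sentence (A : fm []) : models term_model A <-> holds (k := 0) A.
Proof.
  assert (E := truth A (n := 0) (@ids [])); rewrite fsub_ids in E; rewrite <- E.
  unfold models.
  rewrite (subst_nil_ext (vnil (car term_model)) (fun s v => glob (n := 0) (ids v))).
  reflexivity.
Qed.

Lemma term_model_theorem (A : fm []) : prv T [] A -> models term_model A.
Proof.
  intro H; apply truth_sentence, (holds_prv (k := 0)), (prv_weaken H).
  intros x [].
Qed.

Lemma term_model_refutes : ~ models term_model A0.
Proof.
  rewrite truth_sentence; apply (@holds_not 0 A0), (holds_prv (k := 0)), prv_hyp.
  left; reflexivity.
Qed.

End Henkin.

(** * Extensional models *)

Fixpoint ext_eq (M : structure) (s : ty) : car M s -> car M s -> Prop :=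
  match s with
  | N => fun a b => eq0 a b
  | Arr r t => fun f g => forall x : car M r, ext_eq (app f x) (app g x)
  end.

Lemma sat_eq_at (M : structure) s : forall (G : list ty) (a b : tm G s) (e : valuation M G),
  sat (eq_at a b) e <-> ext_eq (teval a e) (teval b e).
Proof.
  induction s as [|r _ t IH]; intros G a b e; simpl; [reflexivity|].
  split; intros H x; specialize (H x); apply IH in H || apply IH;
    simpl in *; unfold twk in *; rewrite !teval_tsub in *; exact H.
Qed.

Record is_congruent (M : structure) : Prop := {
  eq0_refl : forall a : car M N, eq0 a a;
  eq0_eucl : forall a b c : car M N, eq0 a b -> eq0 a c -> eq0 b c;
  lt0_eql : forall a b c : car M N, eq0 a b -> lt0 a c -> lt0 b c;
  lt0_eqr : forall a b c : car M N, eq0 a b -> lt0 c a -> lt0 c b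
}.

Lemma term_model_congruent (T : theory) (A0 : fm []) :
  ~ prv T [] A0 -> is_congruent (term_model T A0).
Proof.
  intro H; pose proof (fun A => term_model_theorem (A := A) H) as Th.
  split.
  - refine (Th (All N (#0 =' #0)) _); apply prv_allI, prv_eqI.
  - refine (Th (All N (All N (All N (#2 =' #1 -->' #2 =' #0 -->' #1 =' #0)))) _).
    do 3 apply prv_allI; do 2 apply prv_impI.
    apply (prv_eqE (A := #0 =' #1) (a := #2) (b := #1)); apply prv_hyp; simpl; auto.
  - refine (Th (All N (All N (All N (#2 =' #1 -->' #2 <' #0 -->' #1 <' #0)))) _).
    do 3 apply prv_allI; do 2 apply prv_impI.
    apply (prv_eqE (A := #0 <' #1) (a := #2) (b := #1)); apply prv_hyp; simpl; auto.
  - refine (Th (All N (All N (All N (#2 =' #1 -->' #0 <' #2 -->' #0 <' #1)))) _).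
    do 3 apply prv_allI; do 2 apply prv_impI.
    apply (prv_eqE (A := #1 <' #0) (a := #2) (b := #1)); apply prv_hyp; simpl; auto.
Qed.

Section Quotient.

Variable M : structure.
Hypothesis M_cong : is_congruent M.
Hypothesis M_ext : forall r t (f : car M (r ~> t)) (x y : car M r),
  ext_eq x y -> ext_eq (app f x) (app f y).

Lemma ext_eq_refl s (a : car M s) : ext_eq a a.
Proof. induction s; simpl; [apply eq0_refl, M_cong | auto]. Qed.

Lemma ext_eq_eucl s (a b c : car M s) : ext_eq a b -> ext_eq a c -> ext_eq b c.
Proof.
  revert a b c; induction s; simpl; intros a b c H1 H2; [|eauto].
  eapply eq0_eucl; eauto.
Qed.

Lemma ext_eq_sym s (a b : car M s) : ext_eq a b -> ext_eq b a.
Proof. intro H; exact (ext_eq_eucl H (ext_eq_refl a)). Qed.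

(** Classes are predicates, so that extensionally equal elements have equal classes by propositional
    extensionality and proof irrelevance. *)
Definition qcar (s : ty) : Type := {P : car M s -> Prop | exists a, P = ext_eq a}.

Definition cls s (a : car M s) : qcar s := exist _ (ext_eq a) (ex_intro _ a eq_refl).

Definition rep s (x : qcar s) : car M s :=
  proj1_sig (constructive_indefinite_description _ (proj2_sig x)).

Lemma cls_rep s (x : qcar s) : cls (rep x) = x.
Proof.
  unfold rep; destruct constructive_indefinite_description as [a Ha]; simpl.
  destruct x as [P HP]; simpl in *; subst P.
  unfold cls; f_equal; apply proof_irrelevance.
Qed.

Lemma cls_eq s (a b : car M s) : cls a = cls b <-> ext_eq a b.
Proof.
  split; intro H.
  - apply (f_equal (@proj1_sig _ _)) in H; simpl in H; rewrite H; apply ext_eq_refl.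
  - assert (E : ext_eq a = ext_eq b).
    { apply functional_extensionality; intro c; apply propositional_extensionality.
      split; apply ext_eq_eucl; auto using ext_eq_sym. }
    unfold cls; revert E; generalize (ex_intro (fun c => ext_eq a = ext_eq c) a eq_refl).
    generalize (ex_intro (fun c => ext_eq b = ext_eq c) b eq_refl).
    generalize (ext_eq a); intros P p q ->; f_equal; apply proof_irrelevance.
Qed.

Lemma rep_cls s (a : car M s) : ext_eq (rep (cls a)) a.
Proof. apply cls_eq, cls_rep. Qed.

Definition quotient : structure := {|
  alg := {| car := qcar; cst := fun s c => cls (cst M c);
            app := fun s t f x => cls (app (rep f) (rep x)) |};
  eq0 := fun x y : qcar N => x = y;
  lt0 := fun x y : qcar N => lt0 (rep x) (rep y)
|}.

(** Replacing the function is harmless by the definition of [ext_eq] at arrow types; replacing the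
    argument is where the extensionality axioms enter, through [M_ext]. *)
Lemma app_cls s t (f : car M (s ~> t)) (x : car M s) :
  app (a := quotient) (cls f) (cls x : car quotient s) = cls (app f x).
Proof.
  simpl; apply cls_eq; apply ext_eq_eucl with (app f (rep (cls x))).
  - apply ext_eq_sym, (rep_cls f).
  - apply M_ext, rep_cls.
Qed.

Lemma quotient_ext s t (f g : car quotient (s ~> t)) :
  (forall x, app f x = app g x) -> f = g.
Proof.
  intro H; rewrite <- (cls_rep f), <- (cls_rep g); apply cls_eq; intro x.
  apply cls_eq; rewrite <- !app_cls, !cls_rep; apply H.
Qed.

Lemma teval_quotient (G : list ty) s (a : tm G s) (e : valuation M G) :
  teval (M := quotient) a (fun s v => cls (e s v)) = cls (teval a e).
Proof.
  induction a; [reflexivity | reflexivity |].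
  cbn [teval]; rewrite IHa1, IHa2; apply app_cls.
Qed.

Lemma sat_quotient (G : list ty) (A : fm G) : forall e : valuation M G,
  sat (M := quotient) A (fun s v => cls (e s v)) <-> sat A e.
Proof.
  assert (C : forall G s (x : car M s) (e : valuation M G),
    vcons (cls x) (fun s v => cls (e s v)) = fun s' v => cls (vcons x e (s := s') v)).
  { intros; apply subst_ext; reflexivity. }
  assert (R1 := @rep_cls N : forall a, eq0 (rep (cls a)) a).
  assert (R2 := fun a => ext_eq_sym (@rep_cls N a) : eq0 a (rep (cls a))).
  induction A; intro e; cbn [sat].
  - rewrite !teval_quotient; apply cls_eq.
  - rewrite !teval_quotient; simpl; split; intro H.
    + eapply lt0_eql, lt0_eqr, H; auto.
    + eapply lt0_eql, lt0_eqr, H; auto.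
  - reflexivity.
  - rewrite IHA1, IHA2; reflexivity.
  - rewrite IHA1, IHA2; reflexivity.
  - rewrite IHA1, IHA2; reflexivity.
  - split; intros H x.
    + apply IHA; rewrite <- C; apply H.
    + rewrite <- (cls_rep x), C; apply IHA, H.
  - split; intros [x H].
    + exists (rep x); apply IHA; rewrite <- C, cls_rep; exact H.
    + exists (cls x : car quotient s); rewrite C; apply IHA, H.
Qed.

End Quotient.

Record is_extensional (M : structure) : Prop := {
  eq0_eq : forall a b : car M N, eq0 a b <-> a = b;
  app_ext : forall s t (f g : car M (s ~> t)), (forall x, app f x = app g x) -> f = g
}.

(** If [A] is unprovable, the term model refutes it; the quotient by extensional equality satisfies
    the same sentences and is extensional. *)
Theorem completeness (T : theory) (A : fm []) :
  (forall r t, T (ax_ext r t)) ->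
  (forall M, is_extensional M -> (forall B, T B -> models M B) -> models M A) ->
  prv T [] A.
Proof.
  intros HT H; apply NNPP; intro HA.
  assert (HM : forall B, T B -> models (term_model T A) B).
  { intros B HB; apply (term_model_theorem HA).
    rewrite <- (fsub_ids B), (subst_nil_ext (@ids []) (@from_nil [])).
    apply prv_ax, HB. }
  assert (C := term_model_congruent HA).
  assert (E : forall r t (f : car (term_model T A) (r ~> t)) x y,
    ext_eq x y -> ext_eq (app f x) (app f y)).
  { intros r t f x y Hxy; assert (X := HM _ (HT r t) f x y); simpl in X.
    rewrite !sat_eq_at in X; apply X, Hxy. }
  assert (Q : forall B, models (quotient (term_model T A)) B <-> models (term_model T A) B).
  { intro B; unfold models; rewrite <- (sat_quotient C E).
    rewrite (subst_nil_ext (vnil (car (quotient (term_model T A))))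
               (fun s v => cls (vnil (car (term_model T A)) v))).
    reflexivity. }
  apply (term_model_refutes HA), Q, H.
  - split; [reflexivity|]; apply (quotient_ext C E).
  - intros B HB; apply Q, HM, HB.
Qed.

(** * Definability in a model *)

Section Model.

Variable M : structure.
Hypothesis M_ext : is_extensional M.
Hypothesis M_ax : forall B, add_axiom ACA0w LIND4 B -> models M B.

Notation num := (car M N).
Notation fn := (car M ty1).
Notation tl e := (fun t v => e t (VS v)).

Lemma M_RCA B : RCA0w B -> models M B.
Proof. intro H; apply M_ax; left; left; exact H. Qed.

Lemma ext_eq_eq s (a b : car M s) : ext_eq a b <-> a = b.
Proof.
  induction s as [|r _ t IH]; simpl; [apply M_ext|].
  split; [|intros -> x; apply IH; reflexivity].
  intro H; apply (app_ext M_ext); intro x; apply IH, H.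
Qed.

Lemma K_eq r s (a : car M r) (b : car M s) : app (app (cst M (cK r s)) a) b = a.
Proof.
  assert (H := M_RCA (RCA0w_K r s) a b).
  apply sat_eq_at, ext_eq_eq in H; exact H.
Qed.

Lemma S_eq r s t (f : car M (r ~> s ~> t)) (g : car M (r ~> s)) (a : car M r) :
  app (app (app (cst M (cS r s t)) f) g) a = app (app f a) (app g a).
Proof.
  assert (H := M_RCA (RCA0w_S r s t) f g a).
  apply sat_eq_at, ext_eq_eq in H; exact H.
Qed.

(** The semantic counterpart of terms: functions of the environment built by application from
    variables and from arbitrary elements of the model. *)
Inductive dfn (G : list ty) : forall t, (valuation M G -> car M t) -> Prop :=
| dfn_var : forall t (v : var G t), dfn (fun e => e t v)
| dfn_par : forall t (a : car M t), dfn (fun _ => a)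
| dfn_app : forall s t (F : valuation M G -> car M (s ~> t)) (X : valuation M G -> car M s),
    dfn F -> dfn X -> dfn (fun e => app (F e) (X e)).

Lemma dfn_subst (G H : list ty) t (F : valuation M H -> car M t)
    (f : valuation M G -> valuation M H) :
  dfn F -> (forall s v, dfn (fun e => f e s v)) -> dfn (fun e => F (f e)).
Proof.
  intros HF Hf; induction HF; [apply Hf | apply dfn_par | apply dfn_app; assumption].
Qed.

(** Bracket abstraction: the abstracted variable becomes [S K K], any other atom is preceded by [K],
    and an application is distributed by [S]. *)
Lemma dfn_abs (G : list ty) s t (F : valuation M (s :: G) -> car M t) :
  dfn F -> exists L : valuation M G -> car M (s ~> t),
    dfn L /\ forall e x, app (L e) x = F (vcons x e).
Proof.
  intro HF; induction HF.
  - revert t v; apply var_cons_ind.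
    + exists (fun _ => app (app (cst M (cS s (s ~> s) s)) (cst M (cK s (s ~> s)))) (cst M (cK s s))).
      split; [apply dfn_par|]; intros e x; rewrite S_eq, K_eq; reflexivity.
    + intros t v; exists (fun e => app (cst M (cK t s)) (e t v)).
      split; [apply dfn_app; [apply dfn_par | apply dfn_var]|].
      intros e x; apply K_eq.
  - exists (fun _ => app (cst M (cK t s)) a); split; [apply dfn_par|].
    intros e x; apply K_eq.
  - destruct IHHF1 as (L1 & H1 & E1), IHHF2 as (L2 & H2 & E2).
    exists (fun e => app (app (cst M (cS s s0 t)) (L1 e)) (L2 e)); split.
    + repeat apply dfn_app; auto; apply dfn_par.
    + intros e x; rewrite S_eq, E1, E2; reflexivity.
Qed.

Definition zero : num := cst M cZero.
Definition one : num := cst M cOne.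
Definition add (a b : num) : num := app (app (cst M cAdd) a) b.
Definition mul (a b : num) : num := app (app (cst M cMul) a) b.
Definition lt (a b : num) : Prop := lt0 a b.

Fixpoint default (s : ty) : car M s :=
  match s with
  | N => zero
  | Arr r t => app (cst M (cK t r)) (default t)
  end.

(* An arbitrary element if the function is not represented in the model. *)
Definition lam s t (F : car M s -> car M t) : car M (s ~> t) :=
  epsilon (inhabits (default (s ~> t))) (fun f => forall x, app f x = F x).

(** By extensionality at most one element represents a function, so the one picked by [epsilon] is
    the one that bracket abstraction gives uniformly in [e]. *)
Lemma dfn_lam (G : list ty) s t (F : car M s -> valuation M G -> car M t) :
  dfn (fun e : valuation M (s :: G) => F (e s V0) (tl e)) ->
  dfn (fun e => lam (fun x => F x e)).
Proof.
  intro H; destruct (dfn_abs H) as (L & HL & E).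
  replace (fun e => lam (fun x => F x e)) with L; [exact HL|].
  apply functional_extensionality; intro e; apply (app_ext M_ext); intro x.
  unfold lam.
  rewrite (epsilon_spec (inhabits (default (s ~> t))) (fun f => forall x, app f x = F x e));
    [apply E | exists (L e); intro; apply E].
Qed.

Lemma app_lam s t (F : car M s -> car M t) (x : car M s) :
  dfn (fun e : valuation M [s] => F (e s V0)) -> app (lam F) x = F x.
Proof.
  intro H; destruct (dfn_abs H) as (L & HL & E).
  unfold lam; apply (epsilon_spec (inhabits (default (s ~> t)))
    (fun f => forall x, app f x = F x)).
  exists (L (vnil (car M))); intro; apply E.
Qed.

Lemma dfn_add (G : list ty) (a b : valuation M G -> num) :
  dfn a -> dfn b -> dfn (fun e => add (a e) (b e)).
Proof. intros; repeat apply dfn_app; auto; apply dfn_par. Qed.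

Lemma dfn_mul (G : list ty) (a b : valuation M G -> num) :
  dfn a -> dfn b -> dfn (fun e => mul (a e) (b e)).
Proof. intros; repeat apply dfn_app; auto; apply dfn_par. Qed.

(** A hook, redefined as further definable operations become available. *)
Ltac dfn_more := fail.

Ltac def_step :=
  cbv beta;
  lazymatch goal with
  | |- dfn (fun _ => ?a) => apply dfn_par
  | |- dfn (fun e => e _ _) => apply dfn_var
  | |- dfn (fun e => lam _) => apply dfn_lam
  | |- dfn (fun e => add _ _) => apply dfn_add
  | |- dfn (fun e => mul _ _) => apply dfn_mul
  | |- dfn (fun e => app _ _) => apply dfn_app
  | |- dfn _ => first [eassumption
     | match goal with
       | H : dfn ?F |- dfn (fun e => ?F (@?f e)) =>
           apply (@dfn_subst _ _ _ F f H); intros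
       | H : forall s v, dfn (fun e => ?p e s v) |- dfn (fun e => ?p (@?f e) ?s ?v) =>
           apply (@dfn_subst _ _ _ (fun e => p e s v) f (H s v)); intros
       end
     | dfn_more]
  end.

Ltac solve_def := repeat def_step; cbv beta; try eassumption.

(** * Arithmetic in a model *)

Lemma M_semiring i : i < 14 -> models M (nth i ordered_semiring_axioms Bot).
Proof. intro H; apply M_RCA, RCA0w_semiring, nth_In, H. Qed.

Ltac use_axiom i :=
  let H := fresh in
  assert (H := @M_semiring i ltac:(lia));
  first [exact H | intros; apply (eq0_eq M_ext); first [apply H | symmetry; apply H]].

Lemma addA a b c : add a (add b c) = add (add a b) c.
Proof. symmetry; use_axiom 0. Qed.

Lemma addC a b : add a b = add b a.
Proof. use_axiom 1. Qed.

Lemma add0 a : add a zero = a.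
Proof. use_axiom 2. Qed.

Lemma mulA a b c : mul a (mul b c) = mul (mul a b) c.
Proof. symmetry; use_axiom 3. Qed.

Lemma mulC a b : mul a b = mul b a.
Proof. use_axiom 4. Qed.

Lemma mul1 a : mul a one = a.
Proof. use_axiom 5. Qed.

Lemma mul0 a : mul a zero = zero.
Proof. use_axiom 6. Qed.

Lemma mulDr a b c : mul a (add b c) = add (mul a b) (mul a c).
Proof. use_axiom 7. Qed.

Lemma lt_irrefl : forall a, ~ lt a a.
Proof. use_axiom 8. Qed.

Lemma lt_trans a b c : lt a b -> lt b c -> lt a c.
Proof. intros H1 H2; exact (@M_semiring 9 ltac:(lia) a b c (conj H1 H2)). Qed.

Lemma lt_total a b : lt a b \/ a = b \/ lt b a.
Proof. rewrite <- (eq0_eq M_ext); exact (@M_semiring 10 ltac:(lia) a b). Qed.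

Lemma lt_addr a b c : lt a b -> lt (add a c) (add b c).
Proof. exact (@M_semiring 11 ltac:(lia) a b c). Qed.

Lemma lt01 : lt zero one.
Proof. use_axiom 13. Qed.

Lemma num_semiring : semi_ring_theory zero one add mul (@eq num).
Proof.
  split; intros.
  - rewrite addC; apply add0.
  - apply addC.
  - apply addA.
  - rewrite mulC; apply mul1.
  - rewrite mulC; apply mul0.
  - apply mulC.
  - apply mulA.
  - rewrite mulC, mulDr, (mulC p n), (mulC p m); reflexivity.
Qed.

Add Ring num_ring : num_semiring.

Lemma lt_addr_inv a b c : lt (add a c) (add b c) -> lt a b.
Proof.
  intro H; destruct (lt_total a b) as [H'|[->|H']]; auto.
  - destruct (lt_irrefl H).
  - destruct (lt_irrefl (lt_trans H (lt_addr c H'))).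
Qed.

Lemma addr_inj a b c : add a c = add b c -> a = b.
Proof.
  intro H; destruct (lt_total a b) as [H'|[->|H']]; auto;
    apply (lt_addr c) in H'; rewrite H in H'; destruct (lt_irrefl H').
Qed.

Lemma zero_le a : lt zero a \/ zero = a.
Proof.
  assert (H := M_RCA (RCA0w_induction (G := []) (A := `0 <' #0 \/' `0 =' #0) eq_refl)).
  enough (X : sat (M := M) (G := [N]) (`0 <' #0 \/' `0 =' #0) (vcons a (vnil (car M)))).
  { destruct X as [X|X]; [left; exact X | right; apply (eq0_eq M_ext), X]. }
  refine (H (conj _ _) a).
  - right; apply (eq0_eq M_ext); reflexivity.
  - intros x [X|X]; left.
    + apply (lt_trans (b := x)); [exact X|].
      assert (Y := lt_addr x lt01); rewrite addC, add0, addC in Y; exact Y.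
    + apply (eq0_eq M_ext) in X; simpl in X.
      assert (Y := lt01); rewrite <- (add0 one), addC in Y.
      change (lt zero (add x one)); rewrite <- X; exact Y.
Qed.

Lemma lt_n0 a : ~ lt a zero.
Proof.
  intro H; destruct (zero_le a) as [H'|<-]; [exact (lt_irrefl (lt_trans H H'))|].
  exact (lt_irrefl H).
Qed.

Lemma lt_add_one a b : lt a (add (add a b) one).
Proof.
  destruct (zero_le b) as [H|<-].
  - replace a with (add zero a) at 1 by ring.
    replace (add (add a b) one) with (add (add b one) a) by ring.
    apply lt_addr, (lt_trans H).
    replace b with (add zero b) at 1 by ring; rewrite (addC b); apply lt_addr, lt01.
  - replace a with (add zero a) at 1 by ring.
    replace (add (add a zero) one) with (add one a) by ring.
    apply lt_addr, lt01.
Qed.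

Lemma succ_neq0 a : add a one <> zero.
Proof.
  intro H; apply (@lt_n0 zero); rewrite <- H at 2.
  replace (add a one) with (add (add zero a) one) by ring; apply lt_add_one.
Qed.

Lemma add_eq0 a b : add a b = zero <-> a = zero /\ b = zero.
Proof.
  split; [|intros [-> ->]; ring].
  assert (C : forall a b, add a b = zero -> a = zero).
  { clear a b; intros a b H; destruct (zero_le a) as [Ha|]; auto.
    assert (X := lt_addr b Ha); rewrite H in X; destruct (lt_n0 X). }
  intro H; split; [exact (C _ _ H)|]; rewrite addC in H; exact (C _ _ H).
Qed.

(** * Arithmetical predicates of a model *)

(** Zero stands for truth, in keeping with [mu2], and falsity may be any other value; conjunction
    thus becomes addition. *)
Definition dpr (G : list ty) (P : valuation M G -> Prop) : Prop :=
  exists c : valuation M G -> num, dfn c /\ forall e, P e <-> c e = zero.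

(* Choice of numbers only takes a single type-1 argument: the numbers [a] and [b]
   are passed to it as the function with values [a] and [a + b] at 0 and 1. *)
Lemma test_atomic (R : num -> num -> Prop) (A : fm [ty1]) :
  qf A = true ->
  (forall x : fn, sat A (vcons x (vnil (car M))) <->
                  R (add (app x zero) (app x zero)) (app x one)) ->
  (forall a b c, R (add a c) (add b c) <-> R a b) ->
  forall G (a b : valuation M G -> num), dfn a -> dfn b -> dpr (fun e => R (a e) (b e)).
Proof.
  intros HA HR Hadd G a b Ha Hb.
  (* Choosing a number with [C] for each function produces a characteristic function of the tested
     relation. *)
  set (C := (wk N A /\' #0 =' `0) \/' (~' wk N A /\' #0 =' `1)).
  assert (HC : qf C = true).
  { assert (W : forall G (B : fm G) D (f : subst G D), qf (fsub B f) = qf B).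
    { induction B; simpl; intros; rewrite ?IHB1, ?IHB2; reflexivity. }
    unfold C, wk; simpl; rewrite !W, HA; reflexivity. }
  assert (SW : forall y x, sat (wk N A) (vcons y (vcons x (vnil (car M)))) <->
                           R (add (app x zero) (app x zero)) (app x one)).
  { intros y x; rewrite <- HR; unfold wk; rewrite sat_fsub; reflexivity. }
  assert (H := M_RCA (RCA0w_choice (QF_AC_intro (G := []) HC))).
  destruct H as [Y HY].
  { intro x; destruct (classic (R (add (app x zero) (app x zero)) (app x one))) as [X|X];
      [exists zero; left | exists one; right];
      (split; [|apply (eq0_eq M_ext); reflexivity]).
    - apply SW, X.
    - intro F; apply SW in F; apply X, F. }
  assert (D : forall x : fn, R (add (app x zero) (app x zero)) (app x one) <-> app Y x = zero).
  { intro x; specialize (HY x); apply sat_fsub in HY.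
    rewrite <- (SW (app Y x) x).
    match type of HY with sat C ?e =>
      replace e with (vcons (app Y x) (vcons x (vnil (car M)))) in HY end.
    2: { apply subst_ext; [|apply var_cons_ind]; [reflexivity.. | intros s v; inversion v]. }
    destruct HY as [[H1 H2]|[H1 H2]]; apply (eq0_eq M_ext) in H2; simpl in H2; fold zero in H2.
    - split; auto.
    - split; [intro; destruct (H1 H)|].
      rewrite H2; intro E; assert (Z := lt01); unfold one in Z; rewrite E in Z.
      destruct (lt_irrefl Z). }
  (* The relation is tested on twice the value at 0 and on the value at 1, that is on [a + a] and
     [a + b]; [Hadd] cancels the common summand [a]. *)
  exists (fun e => app Y (lam (fun i => add (a e) (mul (b e) i)))); split; [solve_def|].
  intro e; rewrite <- D, !app_lam by solve_def.
  rewrite <- (Hadd _ _ (a e)).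
  match goal with |- R ?u ?v <-> R ?u' ?v' =>
    replace u' with u by ring; replace v' with v by ring end.
  reflexivity.
Qed.

Lemma dpr_eq G (a b : valuation M G -> num) : dfn a -> dfn b -> dpr (fun e => a e = b e).
Proof.
  apply (test_atomic (A := #0 @ `0 +' #0 @ `0 =' #0 @ `1)); [reflexivity| |].
  - intro x; apply (eq0_eq M_ext).
  - intros a' b' c; split; [apply addr_inj | intros ->; reflexivity].
Qed.

Lemma dpr_lt G (a b : valuation M G -> num) : dfn a -> dfn b -> dpr (fun e => lt (a e) (b e)).
Proof.
  apply (test_atomic (A := #0 @ `0 +' #0 @ `0 <' #0 @ `1)); [reflexivity| |].
  - reflexivity.
  - intros a' b' c; split; [apply lt_addr_inv | apply lt_addr].
Qed.

Lemma dpr_iff G (P Q : valuation M G -> Prop) : (forall e, P e <-> Q e) -> dpr Q -> dpr P.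
Proof.
  intros H (c & Hc & E); exists c; split; [exact Hc|]; intro e; rewrite H; apply E.
Qed.

Lemma dpr_not G (P : valuation M G -> Prop) : dpr P -> dpr (fun e => ~ P e).
Proof.
  intros (c & Hc & E).
  apply (dpr_iff (Q := fun e => lt zero (c e))); [|apply dpr_lt; solve_def].
  intro e; rewrite E; destruct (zero_le (c e)) as [H|H].
  - split; auto; intros _ X; rewrite X in H; exact (lt_irrefl H).
  - rewrite <- H; split; [tauto|]; intro X; destruct (lt_irrefl X).
Qed.

Lemma dpr_and G (P Q : valuation M G -> Prop) : dpr P -> dpr Q -> dpr (fun e => P e /\ Q e).
Proof.
  intros (c & Hc & E) (d & Hd & F); exists (fun e => add (c e) (d e)).
  split; [solve_def|]; intro e; rewrite E, F, add_eq0; reflexivity.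
Qed.

Lemma dpr_or G (P Q : valuation M G -> Prop) : dpr P -> dpr Q -> dpr (fun e => P e \/ Q e).
Proof.
  intros HP HQ; apply (dpr_iff (Q := fun e => ~ (~ P e /\ ~ Q e))).
  - intro e; tauto.
  - apply dpr_not, dpr_and; apply dpr_not; assumption.
Qed.

Lemma dpr_imp G (P Q : valuation M G -> Prop) : dpr P -> dpr Q -> dpr (fun e => P e -> Q e).
Proof.
  intros HP HQ; apply (dpr_iff (Q := fun e => ~ (P e /\ ~ Q e))).
  - intro e; tauto.
  - apply dpr_not, dpr_and; [|apply dpr_not]; assumption.
Qed.

Lemma dpr_const G (P : Prop) : dpr (fun _ : valuation M G => P).
Proof.
  destruct (classic P) as [H|H].
  - exists (fun _ => zero); split; [apply dfn_par | tauto].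
  - exists (fun _ => add zero one); split; [apply dfn_par|].
    intro; split; [tauto|]; intro X; destruct (succ_neq0 X).
Qed.

Lemma mu_ex : exists mu : car M ty2, forall f : fn,
  (exists n, app f n = zero) -> app f (app mu f) = zero.
Proof.
  assert (H : models M mu2) by (apply M_ax; left; right; reflexivity).
  destruct H as [mu H]; exists mu; intros f [n Hn].
  apply (eq0_eq M_ext), (H f); exists n; apply (eq0_eq M_ext), Hn.
Qed.

(** A characteristic function has a zero iff it vanishes at the argument proposed by [mu], and that
    value is again a term. *)
Lemma dpr_ex G (P : num -> valuation M G -> Prop) :
  dpr (fun e : valuation M (N :: G) => P (e N V0) (tl e)) ->
  dpr (fun e => exists n, P n e).
Proof.
  intros (c & Hc & E); destruct (dfn_abs Hc) as (L & HL & F).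
  destruct mu_ex as [mu Hmu].
  assert (X : forall e n, P n e <-> app (L e) n = zero).
  { intros e n; rewrite F; apply (E (vcons n e)). }
  exists (fun e => app (L e) (app mu (L e))); split; [solve_def|].
  intro e; rewrite <- X; split; [|eauto].
  intros [n Hn]; apply X, Hmu; exists n; apply X, Hn.
Qed.

Lemma dpr_all G (P : num -> valuation M G -> Prop) :
  dpr (fun e : valuation M (N :: G) => P (e N V0) (tl e)) ->
  dpr (fun e => forall n, P n e).
Proof.
  intro H; apply (dpr_iff (Q := fun e => ~ exists n, ~ P n e)).
  - intro e; split; [intros X [n Y]; auto | intros X n; apply NNPP; eauto].
  - apply dpr_not, dpr_ex, dpr_not, H.
Qed.

(* The unique number with a given property, and 0 if there is none. *)
Definition iota (P : num -> Prop) : num :=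
  epsilon (inhabits zero) (fun n => (P n /\ forall m, P m -> m = n) \/
    (~ (exists k, P k /\ forall m, P m -> m = k)) /\ n = zero).

Lemma iota_graph (P : num -> Prop) n : n = iota P <->
  ((P n /\ forall m, P m -> m = n) \/
   (~ (exists k, P k /\ forall m, P m -> m = k)) /\ n = zero).
Proof.
  assert (H : exists n, (P n /\ forall m, P m -> m = n) \/
    (~ (exists k, P k /\ forall m, P m -> m = k)) /\ n = zero).
  { destruct (classic (exists k, P k /\ forall m, P m -> m = k)) as [[k H]|H]; eauto. }
  apply (epsilon_spec (inhabits zero)) in H; fold (iota P) in H.
  split; [intros ->; exact H|].
  intros [[H1 H2]|[H1 H2]]; destruct H as [[H3 H4]|[H3 H4]].
  - apply H4, H1.
  - destruct H3; eauto.
  - destruct H1; eauto.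
  - congruence.

Qed.

Lemma iota_eq (P : num -> Prop) n : P n -> (forall m, P m -> m = n) -> iota P = n.
Proof. intros H1 H2; symmetry; apply iota_graph; auto. Qed.

(** The value [F e] is the only zero of the characteristic function of the graph, so [mu] has to
    return it. *)
Lemma dfn_graph G (F : valuation M G -> num) :
  dpr (fun e : valuation M (N :: G) => e N V0 = F (tl e)) -> dfn F.
Proof.
  intros (c & Hc & E); destruct (dfn_abs Hc) as (L & HL & X).
  destruct mu_ex as [mu Hmu].
  replace F with (fun e => app mu (L e)); [solve_def|].
  apply functional_extensionality; intro e.
  assert (Y : forall n, n = F e <-> app (L e) n = zero).
  { intro n; rewrite X; apply (E (vcons n e)). }
  apply Y, Hmu; exists (F e); apply Y; reflexivity.
Qed.

Ltac dpr_step :=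
  cbv beta;
  lazymatch goal with
  | |- dpr (fun _ => ?a) => apply dpr_const
  | |- dpr (fun e => _ = _) => apply dpr_eq
  | |- dpr (fun e => lt _ _) => apply dpr_lt
  | |- dpr (fun e => ~ _) => apply dpr_not
  | |- dpr (fun e => _ /\ _) => apply dpr_and
  | |- dpr (fun e => _ \/ _) => apply dpr_or
  | |- dpr (fun e => exists n, _) => apply dpr_ex
  | |- dpr (fun e => forall n : car _ _, _) => apply dpr_all
  | |- dpr (fun e => _ -> _) => apply dpr_imp
  | |- dpr (fun e => _) => dfn_more
  | _ => def_step
  end.

Ltac solve_def ::= repeat dpr_step; cbv beta; try eassumption.

Lemma dpr_subst (G H : list ty) (P : valuation M H -> Prop)
    (f : valuation M G -> valuation M H) :
  dpr P -> (forall s v, dfn (fun e => f e s v)) -> dpr (fun e => P (f e)).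
Proof.
  intros (c & Hc & E) Hf; exists (fun e => c (f e)); split; [|auto].
  apply (dfn_subst Hc Hf).
Qed.

Lemma dfn_iota G (P : num -> valuation M G -> Prop) :
  dpr (fun e : valuation M (N :: G) => P (e N V0) (tl e)) ->
  dfn (fun e => iota (fun n => P n e)).
Proof.
  intro H; apply dfn_graph.
  eapply dpr_iff; [intro e; apply iota_graph|].
  assert (W : forall D (n : valuation M D -> num) (f : valuation M D -> valuation M G),
    dfn n -> (forall s v, dfn (fun e => f e s v)) -> dpr (fun e => P (n e) (f e))).
  { intros D n f Hn Hf.
    apply (dpr_subst (f := fun e => vcons (n e) (f e)) H).
    apply var_cons_ind; assumption. }
  solve_def; apply W; intros; solve_def.
Qed.

Ltac dfn_more ::= lazymatch goal with |- dfn (fun e => iota _) => apply dfn_iota end.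

(** [P] enters quantifier-free induction through its characteristic function, which is an element
    [f] of the model and serves as a type-1 parameter. *)
Lemma num_ind (P : num -> Prop) :
  dpr (fun e : valuation M [N] => P (e N V0)) ->
  P zero -> (forall n, P n -> P (add n one)) -> forall n, P n.
Proof.
  intros (c & Hc & E) H0 HS n.
  destruct (dfn_abs Hc) as (L & HL & F); set (f := L (vnil (car M))).
  assert (X : forall n, P n <-> eq0 (app f n) zero).
  { intro m; rewrite (eq0_eq M_ext); unfold f; rewrite F; apply (E (vcons m (vnil (car M)))). }
  assert (H := M_RCA (RCA0w_induction (G := [ty1]) (A := #1 @ #0 =' `0) eq_refl)).
  apply X, (H f); split.
  - apply X, H0.
  - intros m Hm; apply X, HS, X, Hm.
Qed.

Lemma num_cases n : n = zero \/ exists m, n = add m one.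
Proof.
  revert n; apply num_ind; [solve_def | auto |].
  intros n _; right; eauto.
Qed.

Lemma lt_succ m n : lt m (add n one) <-> lt m n \/ m = n.
Proof.
  assert (D : forall n m, lt n m -> ~ lt m (add n one)).
  { apply (num_ind (P := fun n => forall m, lt n m -> ~ lt m (add n one))); [solve_def| |].
    - intros k H1 H2; destruct (num_cases k) as [->|[j ->]]; [exact (lt_irrefl H1)|].
      apply lt_addr_inv in H2; exact (lt_n0 H2).
    - intros k IH j H1 H2; destruct (num_cases j) as [->|[i ->]]; [exact (lt_n0 H1)|].
      apply lt_addr_inv in H1, H2; exact (IH _ H1 H2). }
  assert (L : lt n (add n one)).
  { replace (add n one) with (add (add n zero) one) by ring; apply lt_add_one. }
  split.
  - intro H; destruct (lt_total m n) as [H'|[H'|H']]; auto.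
    destruct (D _ _ H' H).
  - intros [H| ->]; [exact (lt_trans H L) | exact L].
Qed.

Lemma lt_diff m n : lt m n -> exists d, n = add (add m d) one.
Proof.
  revert n; apply (num_ind (P := fun n => lt m n -> exists d, n = add (add m d) one)).
  - solve_def.
  - intro H; destruct (lt_n0 H).
  - intros n IH H; apply lt_succ in H; destruct H as [H|<-].
    + destruct (IH H) as [d ->]; exists (add d one); ring.
    + exists zero; ring.
Qed.

Lemma lt_addl a b c : lt a b -> lt a (add b c).
Proof.
  intro H; destruct (lt_diff H) as [d ->].
  replace (add (add (add a d) one) c) with (add (add a (add d c)) one) by ring.
  apply lt_add_one.
Qed.

(** * Least numbers, definition by cases and pairing *)

Definition least (P : num -> Prop) : num := iota (fun n => P n /\ forall k, lt k n -> ~ P k).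

(** Internal induction shows that, without a least element, [P] fails below every number. The order
    of the model need not be well-founded from outside, so definability of [P] is essential. *)
Lemma least_spec (P : num -> Prop) :
  dpr (fun e : valuation M [N] => P (e N V0)) -> (exists n, P n) -> P (least P).
Proof.
  intros HP [n Hn].
  assert (W : forall D (m : valuation M D -> num), dfn m -> dpr (fun e => P (m e))).
  { intros D m Hm.
    apply (dpr_subst (f := fun e => vcons (m e) (vnil (car M))) HP).
    apply var_cons_ind; [assumption|]; intros s v.
    apply (var_nil_elim (fun v => dfn (fun e : valuation M D => vcons (m e) (vnil (car M)) (VS v)))). }
  assert (L : exists m, P m /\ forall k, lt k m -> ~ P k).
  { apply NNPP; intro F.
    assert (Z : forall m k, lt k m -> ~ P k).
    { apply (num_ind (P := fun m => forall k, lt k m -> ~ P k)).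
      - solve_def; apply W; solve_def.
      - intros k H; destruct (lt_n0 H).
      - intros m IH k Hk; apply lt_succ in Hk; destruct Hk as [Hk|Hk]; [auto|subst k].
        intro; apply F; eauto. }
    apply (Z (add n one) n); [apply lt_succ; auto | exact Hn]. }
  destruct L as (m & H1 & H2); unfold least.
  rewrite (iota_eq (n := m)); auto.
  intros k [H3 H4]; destruct (lt_total k m) as [X|[X|X]]; auto.
  - destruct (H2 _ X H3).
  - destruct (H4 _ X H1).
Qed.

Definition ite (P : Prop) (a b : num) : num := iota (fun n => P /\ n = a \/ ~ P /\ n = b).

Lemma ite_true (P : Prop) a b : P -> ite P a b = a.
Proof. intro H; apply iota_eq; [auto|]; intros m [[_ X]|[X _]]; tauto. Qed.

Lemma ite_false (P : Prop) a b : ~ P -> ite P a b = b.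
Proof. intro H; apply iota_eq; [auto|]; intros m [[X _]|[_ X]]; tauto. Qed.

(** The square of the sum plus [a] avoids the halving in Cantor's pairing. It is not surjective, but
    [iota] makes the projections total. *)
Definition pair (a b : num) : num := add (mul (add a b) (add a b)) a.
Definition left_of (j : num) : num := iota (fun n => exists i, j = pair n i).
Definition right_of (j : num) : num := iota (fun i => exists n, j = pair n i).

Lemma pair_inj a b c d : pair a b = pair c d -> a = c /\ b = d.
Proof.
  assert (C : forall a b c d, pair a b = pair c d -> ~ lt (add a b) (add c d)).
  { clear a b c d; unfold pair; intros a b c d H L; apply lt_diff in L; destruct L as [k E].
    rewrite E in H.
    (* Consecutive squares are too far apart: with [s = a + b] this sum is
       [(s + k + 1)^2 + c - (s^2 + a)], where [2s - a] is written as [a + 2b] to avoid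
       subtraction. *)
    assert (X : add (add (add (add (mul (add a b) (add k k)) (add a (add b b)))
                (add (mul k k) (add k k))) c) one = zero).
    { apply (addr_inj (c := add (mul (add a b) (add a b)) a)); symmetry.
      transitivity (add (mul (add a b) (add a b)) a); [ring|].
      etransitivity; [exact H | ring]. }
    exact (succ_neq0 X). }
  intro H; assert (E : add a b = add c d).
  { destruct (lt_total (add a b) (add c d)) as [X|[X|X]]; auto; [destruct (C _ _ _ _ H X)|].
    symmetry in H; destruct (C _ _ _ _ H X). }
  unfold pair in H; rewrite E, !(addC (mul _ _)) in H; apply addr_inj in H; subst c.
  split; [reflexivity|]; rewrite !(addC a) in E; exact (addr_inj E).
Qed.

Lemma left_pair a b : left_of (pair a b) = a.
Proof.
  apply iota_eq; [eauto|]; intros m [i H]; apply pair_inj in H; destruct H; auto.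
Qed.

Lemma right_pair a b : right_of (pair a b) = b.
Proof.
  apply iota_eq; [eauto|]; intros m [i H]; apply pair_inj in H; destruct H; auto.
Qed.

(** Serves to bound the positions of the entries of a section: those below [a] in section [k] sit
    below [pair k a]. *)
Lemma pair_mono n i k : lt i k -> lt (pair n i) (pair n k).
Proof.
  intro H; destruct (lt_diff H) as [d ->]; unfold pair.
  match goal with |- lt ?u ?v => replace v with
    (add (add u (add (mul (add n i) (add d (add d (add one one)))) (mul d (add d (add one one))))) one)
    by ring end.
  apply lt_add_one.
Qed.

(** * Closed representations of arithmetical predicates *)

Lemma dpr_subst_head (G D : list ty) (P : num -> valuation M G -> Prop)
    (n : valuation M D -> num) (f : valuation M D -> valuation M G) :
  dpr (fun e : valuation M (N :: G) => P (e N V0) (tl e)) ->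
  dfn n -> (forall s v, dfn (fun e => f e s v)) -> dpr (fun e => P (n e) (f e)).
Proof.
  intros HP Hn Hf; apply (dpr_subst (f := fun e => vcons (n e) (f e)) HP).
  apply var_cons_ind; assumption.
Qed.

Lemma dfn_least G (P : num -> valuation M G -> Prop) :
  dpr (fun e : valuation M (N :: G) => P (e N V0) (tl e)) ->
  dfn (fun e => least (fun n => P n e)).
Proof.
  intro H; apply dfn_iota; solve_def; apply (dpr_subst_head H); intros; solve_def.
Qed.

Lemma dfn_ite G (P : valuation M G -> Prop) (a b : valuation M G -> num) :
  dpr P -> dfn a -> dfn b -> dfn (fun e => ite (P e) (a e) (b e)).
Proof.
  intros HP Ha Hb; apply dfn_iota; solve_def;
    apply (dpr_subst (f := fun e => tl e) HP); intros; solve_def.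
Qed.

Lemma dfn_pair G (a b : valuation M G -> num) :
  dfn a -> dfn b -> dfn (fun e => pair (a e) (b e)).
Proof. intros; unfold pair; solve_def. Qed.

Lemma dfn_left G (a : valuation M G -> num) : dfn a -> dfn (fun e => left_of (a e)).
Proof. intro; unfold left_of; apply dfn_iota; unfold pair; solve_def. Qed.

Lemma dfn_right G (a : valuation M G -> num) : dfn a -> dfn (fun e => right_of (a e)).
Proof. intro; unfold right_of; apply dfn_iota; unfold pair; solve_def. Qed.

Definition dsub (G H : list ty) (p : valuation M G -> valuation M H) : Prop :=
  forall s v, dfn (fun e => p e s v).

Lemma dsub_vcons (G H : list ty) s (a : valuation M G -> car M s)
    (p : valuation M G -> valuation M H) :
  dfn a -> dsub p -> dsub (fun e => vcons (a e) (p e)).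
Proof. intros Ha Hp; unfold dsub; apply var_cons_ind; assumption. Qed.

Lemma dsub_const (G H : list ty) (p : valuation M H) : dsub (fun _ : valuation M G => p).
Proof. intros s v; apply dfn_par. Qed.

Lemma dsub_wk (G H : list ty) s (p : valuation M G -> valuation M H) :
  dsub p -> dsub (fun e : valuation M (s :: G) => p (tl e)).
Proof.
  intros Hp t v; apply (dfn_subst (f := fun e : valuation M (s :: G) => tl e) (Hp t v)).
  intros; apply dfn_var.
Qed.

Lemma dsub_tl (G H : list ty) s (p : valuation M G -> valuation M (s :: H)) :
  dsub p -> dsub (fun e => tl (p e)).
Proof. intros Hp t v; apply Hp. Qed.

(** Here and in the four variants below, definability is required for definable arguments in every
    context, so that it can be used underneath binders. *)
Definition def_fun H t (F : valuation M H -> car M t) : Prop :=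
  forall G (p : valuation M G -> valuation M H), dsub p -> dfn (fun e => F (p e)).

Definition def_pred H (P : fn -> valuation M H -> Prop) : Prop :=
  forall G (x : valuation M G -> fn) p, dfn x -> dsub p -> dpr (fun e => P (x e) (p e)).

Definition def_rel H (R : fn -> fn -> valuation M H -> num -> Prop) : Prop :=
  forall G (x g : valuation M G -> fn) p m,
  dfn x -> dfn g -> dsub p -> dfn m -> dpr (fun e => R (x e) (g e) (p e) (m e)).

Definition def_wit H (w : fn -> valuation M H -> fn) : Prop :=
  forall G (x : valuation M G -> fn) p, dfn x -> dsub p -> dfn (fun e => w (x e) (p e)).

Definition def_mod H (k : fn -> fn -> valuation M H -> num -> num) : Prop :=
  forall G (x g : valuation M G -> fn) p m,
  dfn x -> dfn g -> dsub p -> dfn m -> dfn (fun e => k (x e) (g e) (p e) (m e)).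

Definition section (k : num) (g : fn) : fn := lam (fun i => app g (pair k i)).
Definition glue (F : num -> num -> num) : fn := lam (fun j => F (left_of j) (right_of j)).

Lemma dfn_section G (k : valuation M G -> num) (g : valuation M G -> fn) :
  dfn k -> dfn g -> dfn (fun e => section (k e) (g e)).
Proof. intros; unfold section, pair; solve_def. Qed.

Lemma dfn_glue G (F : num -> num -> valuation M G -> num) :
  dfn (fun e : valuation M (N :: G) => F (left_of (e N V0)) (right_of (e N V0)) (tl e)) ->
  dfn (fun e => glue (fun k i => F k i e)).
Proof. intros; apply dfn_lam; assumption. Qed.

Ltac dfn_more ::=
  lazymatch goal with
  | |- dfn (fun e => iota _) => apply dfn_iota
  | |- dfn (fun e => least _) => apply dfn_least
  | |- dfn (fun e => ite _ _ _) => apply dfn_ite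
  | |- dfn (fun e => pair _ _) => apply dfn_pair
  | |- dfn (fun e => left_of _) => apply dfn_left
  | |- dfn (fun e => right_of _) => apply dfn_right
  | |- dfn (fun e => section _ _) => apply dfn_section
  | |- dfn (fun e => glue _) => apply dfn_glue
  | H : def_fun ?F |- dfn (fun e => ?F _) => apply H
  | H : def_wit ?F |- dfn (fun e => ?F _ _) => apply H
  | H : def_mod ?F |- dfn (fun e => ?F _ _ _ _) => apply H
  | H : def_pred ?F |- dpr (fun e => ?F _ _) => apply H
  | H : def_rel ?F |- dpr (fun e => ?F _ _ _ _) => apply H
  end.

Ltac dsub_step :=
  cbv beta;
  lazymatch goal with
  | |- dsub (fun _ => ?p) => apply dsub_const
  | |- dsub (fun e => vcons _ _) => apply dsub_vcons
  | |- dsub (fun e => tl (vcons _ (@?p e))) => change (dsub p)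
  | H : dsub ?p |- dsub (fun e => ?p (tl e)) => apply (dsub_wk _ H)
  | H : dsub ?p |- dsub (fun e => tl (?p e)) => apply (dsub_tl H)
  | H : dsub ?p |- dsub ?p => exact H
  | _ => dpr_step
  end.

Ltac solve_def ::= repeat dsub_step; cbv beta; try eassumption.

Lemma app_section k g i : app (section k g) i = app g (pair k i).
Proof. unfold section; rewrite app_lam; [reflexivity | solve_def]. Qed.

(** Definability of [F] guarantees that [glue F] has the intended values, as [lam] is arbitrary on
    functions that are not represented. *)
Lemma section_glue F k (f : fn) :
  dfn (fun e : valuation M [N] => F (left_of (e N V0)) (right_of (e N V0))) ->
  (forall i, F k i = app f i) -> section k (glue F) = f.
Proof.
  intros HF E; apply (app_ext M_ext); intro i.
  rewrite app_section; unfold glue; rewrite app_lam by exact HF.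
  rewrite left_pair, right_pair; apply E.
Qed.

Definition agree (k : num) (x y : fn) : Prop := forall i, lt i k -> app x i = app y i.

Lemma agree_addl a b x y : agree (add a b) x y -> agree a x y.
Proof. intros H i Hi; apply H, lt_addl, Hi. Qed.

Lemma agree_addr a b x y : agree (add a b) x y -> agree b x y.
Proof. rewrite addC; apply agree_addl. Qed.

Lemma agree_sym a x y : agree a x y -> agree a y x.
Proof. intros H i Hi; symmetry; apply H, Hi. Qed.

Lemma agree_section k a x y : agree (pair k a) x y -> agree a (section k x) (section k y).
Proof. intros H i Hi; rewrite !app_section; apply H, pair_mono, Hi. Qed.

(* [P x p] holds iff [exists g, forall m, R x g p m], where [k] is a modulus of
   continuity of [R] in [x] and [g].  The witness [w] is definable from [x], so that no
   choice is needed when [P] is quantified universally. *)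
Inductive closed_repr H (P : fn -> valuation M H -> Prop) : Prop :=
| closed_repr_intro : forall R w k,
    def_rel R -> def_wit w -> def_mod k ->
    (forall x p g, (forall m, R x g p m) -> P x p) ->
    (forall x p, P x p -> forall m, R x (w x p) p m) ->
    (forall x g p m x' g', agree (k x g p m) x x' -> agree (k x g p m) g g' ->
       (R x g p m <-> R x' g' p m)) ->
    closed_repr P.

(** * Closure properties of closed representations *)

Lemma closed_ext H (P Q : fn -> valuation M H -> Prop) :
  (forall x p, P x p <-> Q x p) -> closed_repr Q -> closed_repr P.
Proof.
  intro E; replace P with Q; [auto|].
  do 2 (apply functional_extensionality; intro); symmetry; apply propositional_extensionality, E.
Qed.

Lemma def_pred_ext H (P Q : fn -> valuation M H -> Prop) :
  (forall x p, P x p <-> Q x p) -> def_pred Q -> def_pred P.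
Proof. intros E HQ G x p Hx Hp; apply (dpr_iff (fun e => E (x e) (p e))), HQ; assumption. Qed.

Lemma closed_atomic H (P : fn -> valuation M H -> Prop) (k : valuation M H -> num) :
  def_pred P -> def_fun k ->
  (forall x x' p, agree (k p) x x' -> (P x p <-> P x' p)) -> closed_repr P.
Proof.
  intros HP Hk HA.
  apply (@closed_repr_intro H P (fun x _ p _ => P x p) (fun _ _ => default ty1)
           (fun _ _ p _ => k p)).
  - intros G x g p m Hx _ Hp _; apply HP; assumption.
  - intros G x p _ _; apply dfn_par.
  - intros G x g p m _ _ Hp _; apply Hk, Hp.
  - intros x p g F; exact (F zero).
  - intros x p F m; exact F.
  - intros x g p m x' g' Hx _; apply HA, Hx.
Qed.

Lemma closed_wk H (P : fn -> valuation M H -> Prop) :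
  closed_repr P -> closed_repr (fun x (p : valuation M (N :: H)) => P x (tl p)).
Proof.
  intros [R w k HR Hw Hk H1 H2 H3].
  apply (@closed_repr_intro (N :: H) (fun x p => P x (tl p)) (fun x g p m => R x g (tl p) m)
           (fun x p => w x (tl p)) (fun x g p m => k x g (tl p) m)).
  - intros G x g p m Hx Hg Hp Hm; apply HR; solve_def.
  - intros G x p Hx Hp; apply Hw; solve_def.
  - intros G x g p m Hx Hg Hp Hm; apply Hk; solve_def.
  - intros x p g; apply H1.
  - intros x p; apply H2.
  - intros x g p m; apply H3.
Qed.

(** Since [D] does not depend on [x], switching between the two relations causes no discontinuity,
    and the sum of the two moduli works for both. *)
Lemma closed_case H (D : valuation M H -> Prop) (P Q : fn -> valuation M H -> Prop) :
  def_pred (fun _ p => D p) -> closed_repr P -> closed_repr Q ->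
  closed_repr (fun x p => (D p -> P x p) /\ (~ D p -> Q x p)).
Proof.
  intros HD [R w k HR Hw Hk H1 H2 H3] [R' w' k' HR' Hw' Hk' H1' H2' H3'].
  assert (HD' : forall G (p : valuation M G -> valuation M H),
             dsub p -> dpr (fun e => D (p e))).
  { intros G p Hp; apply (HD G (fun _ => default ty1)); solve_def. }
  apply closed_repr_intro with
    (R := fun x g p m => (D p -> R x g p m) /\ (~ D p -> R' x g p m))
    (w := fun x p => lam (fun i => ite (D p) (app (w x p) i) (app (w' x p) i)))
    (k := fun x g p m => add (k x g p m) (k' x g p m)).
  - intros G x g p m Hx Hg Hp Hm; solve_def; apply HD', Hp.
  - intros G x p Hx Hp; solve_def; apply HD'; solve_def.
  - intros G x g p m Hx Hg Hp Hm; solve_def.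
  - intros x p g F; split; intro HDp.
    + apply (H1 x p g); intro m; apply F, HDp.
    + apply (H1' x p g); intro m; apply F, HDp.
  - intros x p [F F'] m; split; intro HDp.
    + replace (lam _) with (w x p); [auto|].
      apply (app_ext M_ext); intro i; rewrite app_lam, ite_true; auto; solve_def.
    + replace (lam _) with (w' x p); [auto|].
      apply (app_ext M_ext); intro i; rewrite app_lam, ite_false; auto; solve_def.
  - intros x g p m x' g' Hx Hg.
    rewrite (H3 x g p m x' g'), (H3' x g p m x' g');
      eauto using agree_addl, agree_addr; reflexivity.
Qed.

(** Section [n] of [g] is the witness for [n], and [m] codes [n] together with the inner universal
    variable. To fix [a] entries of section [n], the modulus goes up to [pair n a]. *)
Lemma closed_all H (P : fn -> valuation M (N :: H) -> Prop) :
  closed_repr P -> closed_repr (fun x p => forall n : num, P x (vcons n p)).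
Proof.
  intros [R w k HR Hw Hk H1 H2 H3].
  apply closed_repr_intro with
    (R := fun x g p m => R x (section (left_of m) g) (vcons (left_of m) p) (right_of m))
    (w := fun x p => glue (fun n i => app (w x (vcons n p)) i))
    (k := fun x g p m =>
            let a := k x (section (left_of m) g) (vcons (left_of m) p) (right_of m) in
            add a (pair (left_of m) a)).
  - intros G x g p m Hx Hg Hp Hm; solve_def.
  - intros G x p Hx Hp; solve_def.
  - intros G x g p m Hx Hg Hp Hm; cbv zeta; solve_def.
  - intros x p g F n; apply (H1 x (vcons n p) (section n g)); intro m.
    specialize (F (pair n m)); rewrite left_pair, right_pair in F; exact F.
  - intros x p F m; rewrite (section_glue (f := w x (vcons (left_of m) p))); auto.
    solve_def.
  - intros x g p m x' g' Hx Hg; cbv zeta in *; apply H3; eauto using agree_addl.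
    apply agree_section; eauto using agree_addr.
Qed.

(** The new witness stores the number at position [o] and the old witness in section 1. It is
    defined from [x] by taking the least number, which needs [P] to be decided by a term. *)
Lemma closed_ex H (P : fn -> valuation M (N :: H) -> Prop) :
  def_pred P -> closed_repr P -> closed_repr (fun x p => exists n : num, P x (vcons n p)).
Proof.
  intros HP [R w k HR Hw Hk H1 H2 H3].
  pose (o := pair zero zero).
  pose (n0 := fun x p => least (fun n => P x (vcons n p))).
  pose (F := fun x p n i => ite (n = zero) (n0 x p) (app (w x (vcons (n0 x p) p)) i)).
  assert (Hn0 : forall G (x : valuation M G -> fn) p, dfn x -> dsub p ->
             dfn (fun e => n0 (x e) (p e))).
  { intros G x p Hx Hp; unfold n0; solve_def. }
  apply closed_repr_intro with
    (R := fun x g p m => R x (section one g) (vcons (app g o) p) m)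
    (w := fun x p => glue (F x p))
    (* The part [pair one a] covers the entries of section 1 that matter, and [o + 1] includes
       position [o] itself, so that the number read off stays the same. *)
    (k := fun x g p m => let a := k x (section one g) (vcons (app g o) p) m in
                         add a (add (pair one a) (add o one))).
  - intros G x g p m Hx Hg Hp Hm; solve_def.
  - intros G x p Hx Hp; unfold F; solve_def; apply Hn0; solve_def.
  - intros G x g p m Hx Hg Hp Hm; cbv zeta; solve_def.
  - intros x p g X; exists (app g o); exact (H1 _ _ _ X).
  - intros x p Hex m.
    assert (DF : dfn (fun e : valuation M [N] => F x p (left_of (e N V0)) (right_of (e N V0)))).
    { unfold F; solve_def. }
    assert (E0 : app (glue (F x p)) o = n0 x p).
    { unfold glue, o; rewrite app_lam by exact DF.
      rewrite left_pair; apply ite_true; reflexivity. }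
    rewrite E0, (section_glue (f := w x (vcons (n0 x p) p))); auto.
    + apply H2; refine (least_spec _ Hex); solve_def.
    + intro i; apply ite_false; intro X; assert (Y := lt01); rewrite X in Y.
      exact (lt_irrefl Y).
  - intros x g p m x' g' Hx Hg; cbv zeta in *.
    rewrite <- (Hg o).
    + apply H3; eauto using agree_addl.
      apply agree_section; eauto using agree_addl, agree_addr.
    + match goal with |- lt o (add ?a (add ?b (add o one))) =>
        replace (add a (add b (add o one))) with (add (add o (add a b)) one) by ring end.
      apply lt_add_one.
Qed.

(** A conjunction is a universal quantifier over a case number: zero selects [P], all other numbers
    select [Q]. *)
Lemma closed_and H (P Q : fn -> valuation M H -> Prop) :
  closed_repr P -> closed_repr Q -> closed_repr (fun x p => P x p /\ Q x p).
Proof.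
  intros HP HQ.
  pose (C := fun x (p : valuation M (N :: H)) =>
    (p N V0 = zero -> P x (tl p)) /\ (p N V0 <> zero -> Q x (tl p))).
  apply closed_ext with (fun x p => forall n : num, C x (vcons n p)).
  - intros x p; unfold C; simpl; split; [tauto|]; intro F; split.
    + apply (F zero); reflexivity.
    + apply (F (add zero one)), succ_neq0.
  - apply closed_all, (closed_case (D := fun p => p N V0 = zero)); try apply closed_wk; auto.
    intros G x p Hx Hp; apply dpr_eq; [apply Hp | apply dfn_par].
Qed.

(** Dually, the case number is quantified existentially. Its least value has to be definable, hence
    the two [def_pred] hypotheses. *)
Lemma closed_or H (P Q : fn -> valuation M H -> Prop) :
  def_pred P -> def_pred Q ->
  closed_repr P -> closed_repr Q -> closed_repr (fun x p => P x p \/ Q x p).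
Proof.
  intros DP DQ HP HQ.
  pose (C := fun x (p : valuation M (N :: H)) =>
    (p N V0 = zero -> P x (tl p)) /\ (p N V0 <> zero -> Q x (tl p))).
  apply closed_ext with (fun x p => exists n : num, C x (vcons n p)).
  - intros x p; unfold C; simpl; split.
    + intros [F|F]; [exists zero | exists (add zero one)]; split; try tauto.
      intro X; destruct (succ_neq0 X).
    + intros [n [F1 F2]]; destruct (classic (n = zero)); tauto.
  - apply closed_ex.
    + intros G x p Hx Hp.
      assert (Hn : dfn (fun e => p e N V0)) by apply Hp.
      unfold C; solve_def.
    + apply (closed_case (D := fun p => p N V0 = zero)); try apply closed_wk; auto.
      intros G x p Hx Hp; apply dpr_eq; [apply Hp | apply dfn_par].
Qed.

(** * The Lindelof lemma *)

Lemma lindelof (Psi : car M ty2) : exists F : car M (N ~> ty1),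
  forall g, exists n, agree (app Psi (app F n)) g (app F n).
Proof.
  assert (H : models M LIND4) by (apply M_ax; right; reflexivity).
  destruct (H Psi) as [F HF]; exists F; intro g.
  destruct (HF g) as [n Hn]; exists n; intros i Hi.
  apply (eq0_eq M_ext), (Hn i Hi).
Qed.

(* A function [f] codes a number, a function and a witness in its sections 0, 1, 2.  The
   neighbourhood that [Psi] assigns to an [f] whose witness fails contains no code with a
   correct witness, so the Lindelof sequence must meet every nonempty fibre of [P] in
   a correct code. *)
Lemma closed_comprehension (P : fn -> valuation M [N] -> Prop) :
  closed_repr P -> exists X : fn, (forall n, app X n = zero \/ app X n = one) /\
    forall n, app X n = one <-> ~ exists x, P x (vcons n (vnil (car M))).
Proof.
  intros [R w k HR Hw Hk H1 H2 H3].
  pose (two := add one one); pose (o := pair zero zero).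
  pose (env := fun n : num => vcons n (vnil (car M)) : valuation M [N]).
  pose (Rf := fun f m => R (section one f) (section two f) (env (app f o)) m).
  pose (kf := fun f m => k (section one f) (section two f) (env (app f o)) m).
  assert (Henv : forall G (a : valuation M G -> num), dfn a -> dsub (fun e => env (a e))).
  { intros G a Ha; unfold env; solve_def. }
  assert (HRf : forall G (f : valuation M G -> fn) m, dfn f -> dfn m ->
            dpr (fun e => Rf (f e) (m e))).
  { intros G f m Hf Hm; unfold Rf; solve_def; apply Henv; solve_def. }
  assert (Hkf : forall G (f : valuation M G -> fn) m, dfn f -> dfn m ->
            dfn (fun e => kf (f e) (m e))).
  { intros G f m Hf Hm; unfold kf; solve_def; apply Henv; solve_def. }
  (* A definite failing [m] is needed for [psi] to be a term. *)
  pose (l := fun f => least (fun m => ~ Rf f m)).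
  (* The summand [o + 1] makes the neighbourhood fix the coded number whether or not [f] is correct;
     for an incorrect [f] the other summands fix sections 1 and 2 up to the modulus at [l f]. *)
  pose (psi := fun f => add (ite (forall m : num, Rf f m) zero
                 (add (pair one (kf f (l f))) (pair two (kf f (l f))))) (add o one)).
  assert (Hl : forall G (f : valuation M G -> fn), dfn f -> dfn (fun e => l (f e))).
  { intros G f Hf; unfold l; solve_def; apply HRf; solve_def. }
  assert (Hpsi : forall f, app (lam psi) f = psi f).
  { intro f; apply app_lam; unfold psi; solve_def;
      try apply HRf; try apply Hkf; try apply Hl; solve_def. }
  destruct (lindelof (lam psi)) as [F HF].
  assert (E : forall n, (exists x, P x (env n)) <->
                exists j, app (app F j) o = n /\ forall m : num, Rf (app F j) m).
  { intro n; split.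
    2: { intros (j & <- & HRj); eexists; exact (H1 _ _ _ HRj). }
    intros [x Hx].
    pose (C := fun a i => ite (a = zero) n
                 (ite (a = one) (app x i) (app (w x (env n)) i))).
    assert (HC : dfn (fun e : valuation M [N] => C (left_of (e N V0)) (right_of (e N V0)))).
    { unfold C; solve_def. }
    assert (N1 : one <> zero).
    { intro X; assert (Y := lt01); rewrite X in Y; exact (lt_irrefl Y). }
    assert (N2 : two <> zero) by apply succ_neq0.
    assert (N3 : two <> one).
    { intro X; apply N1; apply (addr_inj (c := one)); rewrite (addC zero), add0; exact X. }
    assert (S0 : app (glue C) o = n).
    { unfold glue, o; rewrite app_lam by exact HC; rewrite left_pair.
      apply ite_true; reflexivity. }
    assert (S1 : section one (glue C) = x).
    { apply section_glue; [exact HC|]; intro i; unfold C.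
      rewrite ite_false, ite_true; auto. }
    assert (S2 : section two (glue C) = w x (env n)).
    { apply section_glue; [exact HC|]; intro i; unfold C.
      rewrite ite_false, ite_false; auto. }
    destruct (HF (glue C)) as [j Hj]; rewrite Hpsi in Hj; exists j.
    unfold psi in Hj.
    assert (Ho : app (app F j) o = n).
    { rewrite <- (Hj o); [exact S0|]; rewrite addC.
      apply lt_addl; rewrite <- (add0 o) at 1.
      replace (add o one) with (add (add o zero) one) by ring.
      rewrite add0 at 1; apply lt_add_one. }
    split; [exact Ho|].
    apply NNPP; intro HN.
    rewrite ite_false in Hj by exact HN.
    assert (HL : ~ Rf (app F j) (l (app F j))).
    { apply (least_spec (P := fun m => ~ Rf (app F j) m)).
      - solve_def; apply HRf; solve_def.
      - apply NNPP; intro X; apply HN; intro m; apply NNPP; intro Y; eauto. }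
    apply HL; unfold Rf.
    (* Continuity is used at the member of the sequence, where [psi] was evaluated; comparing it
       with the correct code makes [R] true there for the very [m] at which it fails. *)
    apply (H3 (section one (app F j)) (section two (app F j)) _ _ x (w x (env n))).
    - rewrite <- S1; apply agree_section, agree_sym; eauto using agree_addl.
    - rewrite <- S2; apply agree_section, agree_sym; eauto using agree_addl, agree_addr.
    - rewrite Ho; apply H2, Hx. }
  (* By [E] the projection is arithmetical in [F], so [ite] can decide it; the value is one off the
     projection because a universal set quantifier is the goal. *)
  pose (X := lam (fun n => ite (exists j, app (app F j) o = n /\ forall m : num, Rf (app F j) m)
                            zero one)).
  assert (HX : forall n, app X n =
    ite (exists j, app (app F j) o = n /\ forall m : num, Rf (app F j) m) zero one).
  { intro n; unfold X; rewrite app_lam; [reflexivity|].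
    solve_def; apply HRf; solve_def. }
  exists X; split; intro n; rewrite HX; fold (env n); [|rewrite E];
    match goal with |- context [ite ?Q _ _] => destruct (classic Q) as [Y|Y] end;
    rewrite ?(ite_true _ _ Y), ?(ite_false _ _ Y); try tauto.
  split; [|tauto]; intro Z; assert (L := lt01); rewrite <- Z in L; destruct (lt_irrefl L).
Qed.

(** * Second-order arithmetic in a model *)

Notation val2 G := (valuation M (ctx_of G)).

Definition indep H t (a : fn -> valuation M H -> car M t) : Prop :=
  exists F, def_fun F /\ forall x p, a x p = F p.

(** The quantified set is [x] itself, and all other values depend only on [p]. An atomic formula
    then consults [x] at positions bounded in terms of [p] alone. *)
Definition tame (H : list ty) (s : sort) :
    (fn -> valuation M H -> car M (ty_of_sort s)) -> Prop :=
  match s with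
  | Num => fun a => indep a
  | Set_ => fun a => indep a \/ forall x p, a x p = x
  end.

Definition tame_env (H : list ty) (G : list sort) (e : fn -> valuation M H -> val2 G) : Prop :=
  forall s (v : var G s), tame (fun x p => e x p _ (var_of v)).

Lemma tame_vcons (H : list ty) (G : list sort) s (a : fn -> valuation M H -> car M (ty_of_sort s))
    (e : fn -> valuation M H -> val2 G) :
  tame a -> tame_env e -> tame_env (G := s :: G) (fun x p => vcons (a x p) (e x p)).
Proof. intros Ha He; unfold tame_env; apply var_cons_ind; assumption. Qed.

Lemma tame_wk (H : list ty) (G : list sort) (e : fn -> valuation M H -> val2 G) :
  tame_env e -> tame_env (fun x (p : valuation M (N :: H)) => e x (tl p)).
Proof.
  assert (W : forall t (a : fn -> valuation M H -> car M t),
             indep a -> indep (fun x (p : valuation M (N :: H)) => a x (tl p))).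
  { intros t a (F & HF & E); exists (fun p => F (tl p)); split.
    - intros G' p Hp; apply HF; intros t' v; apply Hp.
    - intros x p; apply E. }
  intros He [] v; specialize (He _ v); simpl in *; [apply (W _ _ He)|].
  destruct He as [He|He]; [left; apply (W _ _ He) | right; auto].
Qed.

Lemma tm_indep (H : list ty) (G : list sort) (e : fn -> valuation M H -> val2 G) (a : tm2 G) :
  tame_env e -> indep (fun x p => teval (tm_of a) (e x p)).
Proof.
  intro He.
  assert (B : forall (op : num -> num -> num) a b,
    (forall G (f g : valuation M G -> num), dfn f -> dfn g -> dfn (fun e => op (f e) (g e))) ->
    indep a -> indep b -> indep (fun x (p : valuation M H) => op (a x p) (b x p))).
  { intros op f g Hop (F & HF & EF) (F' & HF' & EF').
    exists (fun p => op (F p) (F' p)); split; [|intros; rewrite EF, EF'; reflexivity].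
    intros D p Hp; apply Hop; auto. }
  induction a; simpl.
  - apply (He Num).
  - exists (fun _ => zero); split; [intros D p Hp; apply dfn_par | reflexivity].
  - exists (fun _ => one); split; [intros D p Hp; apply dfn_par | reflexivity].
  - apply (B add); [apply dfn_add | exact IHa1 | exact IHa2].
  - apply (B mul); [apply dfn_mul | exact IHa1 | exact IHa2].
Qed.

(** An invariant stable under negation. The term deciding [P] is what the existential quantifier and
    the disjunction require. *)
Definition decided H (P : fn -> valuation M H -> Prop) : Prop :=
  def_pred P /\ closed_repr P /\ closed_repr (fun x p => ~ P x p).

Lemma decided_ext H (P Q : fn -> valuation M H -> Prop) :
  (forall x p, P x p <-> Q x p) -> decided Q -> decided P.
Proof.
  intros E (H1 & H2 & H3); repeat split.
  - apply (def_pred_ext E), H1.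
  - apply (closed_ext E), H2.
  - apply (closed_ext (Q := fun x p => ~ Q x p)), H3; intros; rewrite E; reflexivity.
Qed.

Lemma decided_atomic H (P : fn -> valuation M H -> Prop) (k : valuation M H -> num) :
  def_pred P -> def_fun k ->
  (forall x x' p, agree (k p) x x' -> (P x p <-> P x' p)) -> decided P.
Proof.
  intros HP Hk HA.
  split; [|split]; [exact HP | apply (closed_atomic HP Hk HA) |].
  apply (closed_atomic (k := k)); auto.
  - intros G x p Hx Hp; apply dpr_not, HP; assumption.
  - intros x x' p Hx; rewrite (HA x x' p Hx); reflexivity.
Qed.

Lemma decided_not H (P : fn -> valuation M H -> Prop) :
  decided P -> decided (fun x p => ~ P x p).
Proof.
  intros (H1 & H2 & H3); split; [|split]; [|exact H3|].
  - intros G x p Hx Hp; apply dpr_not, H1; assumption.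
  - apply (closed_ext (Q := P)); [intros; tauto | exact H2].
Qed.

Lemma decided_and H (P Q : fn -> valuation M H -> Prop) :
  decided P -> decided Q -> decided (fun x p => P x p /\ Q x p).
Proof.
  intros HP HQ; destruct (decided_not HP) as (NP & _), (decided_not HQ) as (NQ & _).
  destruct HP as (H1 & H2 & H3), HQ as (H4 & H5 & H6); split; [|split].
  - intros G x p Hx Hp; apply dpr_and; auto.
  - apply closed_and; assumption.
  - apply (closed_ext (Q := fun x p => ~ P x p \/ ~ Q x p)); [intros; tauto|].
    apply closed_or; assumption.
Qed.

Lemma decided_all H (P : fn -> valuation M (N :: H) -> Prop) :
  decided P -> decided (fun x p => forall n : num, P x (vcons n p)).
Proof.
  intro HP; destruct (decided_not HP) as (NP & _); destruct HP as (H1 & H2 & H3); split; [|split].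
  - intros G x p Hx Hp; solve_def.
  - apply closed_all, H2.
  - apply (closed_ext (Q := fun x p => exists n : num, ~ P x (vcons n p))).
    + intros x p; split; [apply not_all_ex_not | intros [n Hn] F; auto].
    + apply (closed_ex (P := fun x p => ~ P x p)); assumption.
Qed.

(** Implication, disjunction and existential quantification are reduced classically to negation,
    conjunction and universal quantification. *)
Lemma arithmetical_decided (G : list sort) (A : fm2 G) : arithmetical A = true ->
  forall H (e : fn -> valuation M H -> val2 G), tame_env e ->
  decided (fun x p => sat (fm_of A) (e x p)).
Proof.
  assert (T : forall H (op : num -> num -> Prop) a b,
    (forall G (f g : valuation M G -> num), dfn f -> dfn g -> dpr (fun e => op (f e) (g e))) ->
    indep a -> indep b -> decided (fun x (p : valuation M H) => op (a x p) (b x p))).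
  { intros H op a b Hop (F & HF & EF) (F' & HF' & EF').
    apply (decided_ext (Q := fun _ p => op (F p) (F' p))).
    - intros x p; rewrite EF, EF'; reflexivity.
    - apply (decided_atomic (k := fun _ => zero)); [| |reflexivity].
      + intros G' x p Hx Hp; apply Hop; auto.
      + intros G' p Hp; apply dfn_par. }
  induction A; simpl; intros HA H e He.
  - apply (decided_ext (fun x p => eq0_eq M_ext _ _)).
    apply (T H (@eq num)); [apply dpr_eq | apply tm_indep, He ..].
  - apply (T H lt); [apply dpr_lt | apply tm_indep, He ..].
  - apply (decided_ext (fun x p => eq0_eq M_ext _ _)).
    destruct (tm_indep t He) as (F & HF & EF).
    destruct (He Set_ v) as [(X & HX & EX)|EX].
    + apply (T H (@eq num)); [apply dpr_eq | |].
      * exists (fun p => app (X p) (F p)); split; [|intros x p; rewrite <- (EX x p), <- (EF x p); reflexivity].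
        intros D p Hp; apply dfn_app; auto.
      * exists (fun _ => one); split; [intros D p Hp; apply dfn_par | reflexivity].
    + apply (decided_ext (Q := fun x p => app x (F p) = one)).
      { intros x p; cbn in EX; rewrite EX, EF; reflexivity. }
      (* Membership in [x] consults only the entry at [F p], and [agree] is strict in its bound. *)
      apply (decided_atomic (k := fun p => add (F p) one)).
      * intros D x p Hx Hp; solve_def.
      * intros D p Hp; solve_def.
      * intros x x' p Hx; rewrite Hx; [reflexivity|]; apply lt_succ; auto.
  - apply (decided_atomic (k := fun _ => zero)); [| |reflexivity].
    + intros D x p Hx Hp; apply dpr_const.
    + intros D p Hp; apply dfn_par.
  - apply andb_prop in HA; destruct HA as [H1 H2].
    apply (decided_ext (Q := fun x p => ~ (sat (fm_of A1) (e x p) /\ ~ sat (fm_of A2) (e x p)))).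
    { intros; tauto. }
    apply decided_not, decided_and; [|apply decided_not]; auto.
  - apply andb_prop in HA; destruct HA as [H1 H2]; apply decided_and; auto.
  - apply andb_prop in HA; destruct HA as [H1 H2].
    apply (decided_ext (Q := fun x p => ~ (~ sat (fm_of A1) (e x p) /\ ~ sat (fm_of A2) (e x p)))).
    { intros; tauto. }
    apply decided_not, decided_and; apply decided_not; auto.
  - destruct s; [|discriminate].
    apply (decided_all (P := fun x p => sat (fm_of A) (vcons (p N V0) (e x (tl p))))).
    apply (IHA HA (N :: H)), (tame_vcons (s := Num)); [|apply tame_wk, He].
    exists (fun p => p N V0); split; [intros D p Hp; apply Hp | reflexivity].
  - destruct s; [|discriminate].
    apply (decided_ext (Q := fun x p => ~ forall n : num, ~ sat (fm_of A) (vcons n (e x p)))).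
    { intros x p; split; [intros [n Hn] F; exact (F n Hn) | exact (not_all_not_ex _ _)]. }
    apply decided_not.
    apply (decided_all (P := fun x p => ~ sat (fm_of A) (vcons (p N V0) (e x (tl p))))).
    apply decided_not.
    apply (IHA HA (N :: H)), (tame_vcons (s := Num)); [|apply tame_wk, He].
    exists (fun p => p N V0); split; [intros D p Hp; apply Hp | reflexivity].
Qed.

(** * The axioms of second-order arithmetic *)

Definition is_set (x : fn) : Prop := forall n, app x n = zero \/ app x n = one.

Lemma sat_is_char (G : list ty) (f : tm G ty1) (e : valuation M G) :
  sat (is_char f) e <-> is_set (teval f e).
Proof.
  unfold is_set; simpl; unfold twk.
  split; intros F n; specialize (F n); rewrite teval_tsub, !(eq0_eq M_ext) in *; exact F.
Qed.

(** Set quantifiers range over 0-1-valued functions, so this condition becomes part of the predicate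
    that is projected. *)
Lemma is_set_closed H : closed_repr (fun x (_ : valuation M H) => is_set x).
Proof.
  assert (D : forall c, decided (fun x (p : valuation M (N :: H)) => app x (p N V0) = c)).
  { intro c; apply (decided_atomic (k := fun p => add (p N V0) one)).
    - intros G x p Hx Hp; apply dpr_eq; [apply dfn_app; [exact Hx | apply Hp] | apply dfn_par].
    - intros G p Hp; apply dfn_add; [apply Hp | apply dfn_par].
    - intros x x' p Hx; rewrite Hx; [reflexivity|]; apply lt_succ; auto. }
  apply (closed_all (P := fun x (p : valuation M (N :: H)) =>
                            app x (p N V0) = zero \/ app x (p N V0) = one)).
  apply closed_or; apply D.
Qed.

Lemma models_close2 (G : list sort) (A : fm2 G) :
  (forall e : val2 G, sat (fm_of A) e) -> models M (fm_of (close2 A)).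
Proof.
  induction G as [|s G IH]; simpl; intro HA; [apply HA|].
  apply IH; intro e; destruct s; simpl; intros x; [apply HA|]; intros _; apply HA.
Qed.

Lemma sat_fren2 (G : list sort) (A : fm2 G) : forall (D : list sort) (f : renaming G D)
    (e : val2 G) (e' : val2 D),
  (forall s (v : var G s), e _ (var_of v) = e' _ (var_of (f s v))) ->
  sat (fm_of (fren2 A f)) e' <-> sat (fm_of A) e.
Proof.
  assert (Ht : forall G (a : tm2 G) D (f : renaming G D) (e : val2 G) (e' : val2 D),
    (forall s (v : var G s), e _ (var_of v) = e' _ (var_of (f s v))) ->
    teval (tm_of (tren2 f a)) e' = teval (tm_of a) e).
  { intros G' a D f e e' E; induction a; simpl; try congruence.
    symmetry; apply (E Num). }
  assert (U : forall G D s (f : renaming G D) (e : val2 G) (e' : val2 D) (x : car M (ty_of_sort s)),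
    (forall s (v : var G s), e _ (var_of v) = e' _ (var_of (f s v))) ->
    forall t (v : var (s :: G) t),
      (vcons x e : val2 (s :: G)) _ (var_of v) =
      (vcons x e' : val2 (s :: D)) _ (var_of (up_ren f v))).
  { intros G' D s f e e' x E; apply var_cons_ind; [reflexivity | exact E]. }
  induction A; intros D f e e' E; simpl.
  - rewrite !(Ht _ _ _ f e e' E); reflexivity.
  - rewrite !(Ht _ _ _ f e e' E); reflexivity.
  - specialize (E Set_ v) as E'; cbn in E'; rewrite !(Ht _ _ _ f e e' E), E'; reflexivity.
  - reflexivity.
  - rewrite (IHA1 D f e e' E), (IHA2 D f e e' E); reflexivity.
  - rewrite (IHA1 D f e e' E), (IHA2 D f e e' E); reflexivity.
  - rewrite (IHA1 D f e e' E), (IHA2 D f e e' E); reflexivity.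
  - assert (I := fun x => IHA (s :: D) (up_ren f) (vcons x e) (vcons x e') (U _ _ s f e e' x E)).
    destruct s; simpl; split; intros F x; [| | intro C | intro C]; apply I; auto.
  - assert (I := fun x => IHA (s :: D) (up_ren f) (vcons x e) (vcons x e') (U _ _ s f e e' x E)).
    destruct s; simpl; split; intros [x F]; exists x; rewrite I in * || rewrite <- I in *; exact F.
Qed.

(** The wanted set is the complement of a projection, namely that of the sets [x] refuting [B]; the
    negative half of [decided] represents the refutation. *)
Lemma models_comprehension (G : list sort) (phi : fm2 (Num :: G)) :
  Pi11 phi -> models M (fm_of (comprehension_for phi)).
Proof.
  intros (B & HB & ->); apply models_close2; intro e.
  pose (env := fun (x : fn) (p : valuation M [N]) =>
                 vcons x (vcons (p N V0) e) : val2 (Set_ :: Num :: G)).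
  assert (Henv : tame_env env).
  { apply (tame_vcons (s := Set_)); [right; reflexivity|].
    apply (tame_vcons (s := Num)).
    - exists (fun p => p N V0); split; [intros D p Hp; apply Hp | reflexivity].
    - assert (C : forall t (a : car M t), indep (fun _ (_ : valuation M [N]) => a)).
      { intros t a; exists (fun _ => a); split; [intros D p Hp; apply dfn_par | reflexivity]. }
      intros [] v; [apply C | left; apply C]. }
  destruct (arithmetical_decided HB Henv) as (_ & _ & HN).
  destruct (closed_comprehension (closed_and (is_set_closed [N]) HN)) as (X & HX1 & HX2).
  exists X; split; [apply sat_is_char; exact HX1|]; intro n.
  assert (E : app X n = one <-> sat (fm_of (All2 Set_ B)) (vcons n e)).
  { rewrite HX2; split.
    - intros F x Hx; apply NNPP; intro Y; apply F; exists x; split; [|exact Y].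
      apply sat_is_char in Hx; exact Hx.
    - intros F [x [Hx Y]]; apply Y, F, sat_is_char, Hx. }
  rewrite <- (@sat_fren2 _ _ (Num :: Set_ :: G) (up_ren (fun s v => VS v))
                 (vcons n e) (vcons n (vcons X e))) in E.
  - split; intro Y.
    + apply E, (eq0_eq M_ext), Y.
    + apply (eq0_eq M_ext), E, Y.
  - apply var_cons_ind; reflexivity.
Qed.

Lemma models_set_induction : models M (fm_of set_induction).
Proof.
  intros X _ [H0 HS] n; apply (eq0_eq M_ext); simpl; fold one.
  revert n; apply num_ind; [solve_def | |].
  - apply (eq0_eq M_ext), H0.
  - intros n Hn; apply (eq0_eq M_ext), (HS n), (eq0_eq M_ext), Hn.
Qed.

Lemma models_basic (A : fm2 []) : In A basic_axioms2 -> models M (fm_of A).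
Proof.
  simpl; intros [<-|[<-|[<-|[<-|[<-|[<-|[<-|[<-|[]]]]]]]]]; unfold models; simpl;
    repeat (setoid_rewrite (eq0_eq M_ext)); fold zero one.
  - intros x; apply succ_neq0.
  - intros x y; apply addr_inj.
  - apply add0.
  - intros x y; apply addA.
  - apply mul0.
  - intros x y; change (mul x (add y one) = add (mul x y) x); ring.
  - apply lt_n0.
  - intros x y; split; apply (lt_succ x y).
Qed.

End Model.

Theorem corollary4p17 : proves2 (add_axiom ACA0w LIND4) Pi11_CA0.
Proof.
  intros A HA; apply completeness.
  - intros r t; left; left; apply RCA0w_ext.
  - intros M M_ext M_ax; destruct HA.
    + apply models_basic; assumption.
    + apply models_set_induction; assumption.
    + apply models_comprehension; assumption.
Qed.
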